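(* Let $A$ be an associative ring with $1$ and $\rho:A\to A$ a ring automorphism. The homomorphism $\widehat C_2:W_1(A,\rho)\to K_1(A_\rho((z)))$ induced by the inclusion $A_\rho[[z]]\subset A_\rho((z))$ has a left inverse homomorphism $\widehat B_2:K_1(A_\rho((z)))\to W_1(A,\rho)$ which satisfies: (1) $\widehat B_2$ vanishes on the image of $K_1(A)$ in $K_1(A_\rho((z)))$; (2) $\widehat B_2(\tau(z))=0$, where $\tau(z)\in K_1(A_\rho((z)))$ is the torsion of the invertible $1\times1$ matrix $(z)$.
   Context: Let $z$ be an indeterminate with $az=z\rho(a)$ for $a\in A$. $A_\rho[[z]]$ is the ring of power series $\sum_{j\ge 0}a_jz^j$, $a_j\in A$; $A_\rho((z))=A_\rho[[z]][z^{-1}]$ is the ring of series $\sum_{j\in\mathbb Z}a_jz^j$ with $a_j=0$ for all but finitely many $j<0$. $K_1(R)$ is the Whitehead group ($K_1$ of the category of finitely generated projective left $R$-modules), and $\tau(f)\in K_1(R)$ is the class of an automorphism or invertible matrix. $W_1(A,\rho)$ is the subgroup of $K_1(A_\rho[[z]])$ consisting of the torsions $\tau(w)$ of Witt vectors, i.e. units of the form $w=1+\sum_{j\ge1}a_jz^j\in A_\rho[[z]]$. *)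

(* Defs.v *)
From HB Require Import structures.
From mathcomp Require Import all_boot all_order all_algebra zify.
From mathcomp Require Import boolp classical_sets fsbigop.
From mathcomp Require Import freeg.

Set Implicit Arguments.
Unset Strict Implicit.
Unset Printing Implicit Defensive.

Import Order.TTheory GRing.Theory Num.Theory.
Local Open Scope ring_scope.

Definition submod_of (R : pzRingType) (n : nat) (U : submodClosed 'rV[R]_n) :=
  {x : 'rV[R]_n | x \in U}.
HB.instance Definition _ R n U := SubType.on (@submod_of R n U).
HB.instance Definition _ R n U := Choice.on (@submod_of R n U).
HB.instance Definition _ R n U :=
  [SubChoice_isSubLmodule of @submod_of R n U by <:].

Definition finitely_generated (R : pzRingType) (P : lmodType R) : Prop :=
  exists (n : nat) (g : 'I_n -> P), forall x, exists c : 'I_n -> R,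
    x = \sum_(i < n) c i *: g i.

Definition projective (R : pzRingType) (P : lmodType R) : Prop :=
  forall (M N : lmodType R) (p : {linear M -> N}) (f : {linear P -> N}),
    (forall y, exists x, p x = y) ->
    exists g : {linear P -> M}, forall x, p (g x) = f x.

(* K_1 needs a set of generators, so the category of finitely generated
   projective left R-modules is replaced by its full subcategory on the modules
   that are submodules of some R^n (row vectors). By fgproj_iso it meets every
   isomorphism class, and by torsion_iso isomorphic automorphisms have the same
   torsion. *)
Record fgproj (R : pzRingType) := FGProj {
  fgp_dim : nat;
  fgp_sub : submodClosed 'rV[R]_fgp_dim;
  fgp_fg : finitely_generated (submod_of fgp_sub);
  fgp_proj : projective (submod_of fgp_sub) }.

Arguments fgp_proj {R} _ M N p f _.

Coercion fgp_mod (R : pzRingType) (P : fgproj R) : lmodType R :=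
  submod_of (fgp_sub P).

Record fgaut (R : pzRingType) := FGAut {
  aut_mod : fgproj R;
  aut_map : {linear aut_mod -> aut_mod};
  aut_bij : bijective aut_map }.
Arguments FGAut {R aut_mod} aut_map aut_bij.

HB.instance Definition _ (R : pzRingType) := gen_eqMixin (fgaut R).
HB.instance Definition _ (R : pzRingType) := gen_choiceMixin (fgaut R).

(* The relations tau(g o f) = tau(f) + tau(g), and tau(b) = tau(a) + tau(c) for
   every short exact sequence 0 -> a -> b -> c -> 0 of automorphisms. *)
Inductive k1_relator (R : pzRingType) : {freeg fgaut R} -> Prop :=
| K1_comp (P : fgproj R) (f g : {linear P -> P})
    (bf : bijective f) (bg : bijective g) (bgf : bijective (g \o f)) :
    k1_relator (<< FGAut (g \o f) bgf >> - << FGAut f bf >> - << FGAut g bg >>)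
| K1_exact (a b c : fgaut R) (i : {linear aut_mod a -> aut_mod b})
    (j : {linear aut_mod b -> aut_mod c}) :
    injective i -> (forall x, j x = 0 <-> exists y, i y = x) ->
    (forall z, exists x, j x = z) ->
    (forall x, i (aut_map a x) = aut_map b (i x)) ->
    (forall x, j (aut_map b x) = aut_map c (j x)) ->
    k1_relator (<< b >> - << a >> - << c >>).

Definition k1_relations (R : pzRingType) : {pred {freeg fgaut R}} :=
  fun x => `[< forall H : zmodClosed {freeg fgaut R},
                 (forall r, k1_relator r -> r \in H) -> x \in H >].

Fact k1_relations_zmod_closed (R : pzRingType) : zmod_closed (@k1_relations R).
Proof.
split; first by apply/asboolP => H _; exact: rpred0.
move=> x y /asboolP Hx /asboolP Hy; apply/asboolP => H HH.
by rewrite rpredB ?Hx ?Hy.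
Qed.
HB.instance Definition _ (R : pzRingType) :=
  GRing.isZmodClosed.Build _ (@k1_relations R) (@k1_relations_zmod_closed R).

Definition K1 (R : pzRingType) := Quotient.quot (@k1_relations R).
HB.instance Definition _ R := ZmodQuotient.on (@K1 R).

Local Open Scope quotient_scope.

Definition torsion (R : pzRingType) (a : fgaut R) : K1 R := \pi_(K1 R) << a >>.

Section K1Theory.
Variable R : pzRingType.
Implicit Types a b c : fgaut R.

Lemma k1_relatorP x : k1_relator x -> \pi_(K1 R) x = 0.
Proof.
move=> kx; apply/eqP; rewrite -(raddf0 (\pi_(K1 R))) -Quotient.idealrBE subr0.
by apply/asboolP => H /(_ _ kx).
Qed.

Lemma torsion_comp (P : fgproj R) (f g : {linear P -> P})
    (bf : bijective f) (bg : bijective g) (bgf : bijective (g \o f)) :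
  torsion (FGAut (g \o f) bgf) = torsion (FGAut f bf) + torsion (FGAut g bg).
Proof.
apply/eqP; rewrite -subr_eq0 opprD addrA.
by have /k1_relatorP := K1_comp bf bg bgf; rewrite !raddfB => ->.
Qed.

Lemma torsion_exact a b c (i : {linear aut_mod a -> aut_mod b})
    (j : {linear aut_mod b -> aut_mod c}) :
  injective i -> (forall x, j x = 0 <-> exists y, i y = x) ->
  (forall z, exists x, j x = z) ->
  (forall x, i (aut_map a x) = aut_map b (i x)) ->
  (forall x, j (aut_map b x) = aut_map c (j x)) ->
  torsion b = torsion a + torsion c.
Proof.
move=> h1 h2 h3 h4 h5; apply/eqP; rewrite -subr_eq0 opprD addrA.
by have /k1_relatorP := K1_exact h1 h2 h3 h4 h5; rewrite !raddfB => ->.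
Qed.

Lemma eq_FGAut (P : fgproj R) (f g : {linear P -> P}) bf bg :
  f =1 g -> FGAut f bf = FGAut g bg.
Proof.
move=> fg; have efg : f = g.
  case: f g fg {bf bg} => f [[f1] [f2]] [g [[g1] [g2]]] /= /funext fg.
  case: _ / fg in g1 g2 *.
  by rewrite (Prop_irrelevance f1 g1) (Prop_irrelevance f2 g2).
by case: _ / efg in bg *; congr FGAut; exact: Prop_irrelevance.
Qed.

Section Lift.
Variables (G : zmodType) (h : fgaut R -> G).
Let lift0 : {freeg fgaut R} -> G := fglift (h : fgaut R -> ssrint.zmodule G).
Hypothesis h_comp : forall (P : fgproj R) (f g : {linear P -> P})
    (bf : bijective f) (bg : bijective g) (bgf : bijective (g \o f)),
  h (FGAut (g \o f) bgf) = h (FGAut f bf) + h (FGAut g bg).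
Hypothesis h_exact : forall a b c (i : {linear aut_mod a -> aut_mod b})
    (j : {linear aut_mod b -> aut_mod c}),
  injective i -> (forall x, j x = 0 <-> exists y, i y = x) ->
  (forall z, exists x, j x = z) ->
  (forall x, i (aut_map a x) = aut_map b (i x)) ->
  (forall x, j (aut_map b x) = aut_map c (j x)) ->
  h b = h a + h c.

Let lift0B x y : lift0 (x - y) = lift0 x - lift0 y.
Proof. exact: (lift_is_additive (h : fgaut R -> ssrint.zmodule G)). Qed.

Let lift0U a : lift0 << a >> = h a.
Proof. by rewrite /lift0 liftU scale1r. Qed.

Lemma k1_lift_subproof x : x \in @k1_relations R -> lift0 x = 0.
Proof.
pose H : {pred {freeg fgaut R}} := fun x => `[< lift0 x = 0 >].
have HZ : zmod_closed H.
  split; first by apply/asboolP; have := lift0B 0 0; rewrite !subrr.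
  by move=> u v /asboolP Hu /asboolP Hv; apply/asboolP; rewrite lift0B Hu Hv subr0.
pose HH := GRing.isZmodClosed.Build _ H HZ.
pose H' : zmodClosed {freeg fgaut R} := HB.pack H HH.
move=> /asboolP/(_ H') xH; apply/asboolP/xH => r kr; apply/asboolP.
case: kr => [P f g bf bg bgf|a b c i j h1 h2 h3 h4 h5].
  by rewrite !lift0B !lift0U (h_comp bf bg) -addrA -opprD subrr.
by rewrite !lift0B !lift0U (h_exact h1 h2 h3 h4 h5) -addrA -opprD subrr.
Qed.

Lemma k1_lift_exists : exists L : {additive K1 R -> G},
  forall a, L (torsion a) = h a.
Proof.
pose L (x : K1 R) := lift0 (repr x).
have piL x : L (\pi x) = lift0 x.
  apply/eqP; rewrite -subr_eq0 -lift0B; apply/eqP/k1_lift_subproof.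
  by rewrite Quotient.idealrBE reprK.
have LB : zmod_morphism L.
  by move=> x y; rewrite -[x]reprK -[y]reprK -raddfB !piL lift0B.
pose HL := GRing.isZmodMorphism.Build _ _ L LB.
pose L' : {additive K1 R -> G} := HB.pack L HL.
by exists L' => a /=; rewrite piL lift0U.
Qed.
End Lift.
End K1Theory.

Section LinearAux.
Variable R : pzRingType.

Section Comb.
Variables (P : lmodType R) (n : nat) (g : 'I_n -> P).
Definition lin_comb (u : 'rV[R]_n) : P := \sum_(i < n) u 0 i *: g i.
Fact lin_comb_is_linear : linear lin_comb.
Proof.
move=> a u v; rewrite /lin_comb scaler_sumr -big_split /=.
by apply: eq_bigr => i _; rewrite !mxE scalerDl scalerA.
Qed.
HB.instance Definition _ :=
  GRing.isLinear.Build R 'rV[R]_n P _ lin_comb lin_comb_is_linear.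

Lemma lin_comb_delta i : lin_comb (delta_mx 0 i) = g i.
Proof.
rewrite /lin_comb (bigD1 i) //= mxE !eqxx scale1r big1 ?addr0 // => j /negPf ji.
by rewrite mxE ji andbF scale0r.
Qed.
End Comb.

Lemma lin_combE (P : lmodType R) n (f : {linear 'rV[R]_n -> P}) u :
  f u = lin_comb (fun i => f (delta_mx 0 i)) u.
Proof.
rewrite {1}[u]row_sum_delta linear_sum; apply: eq_bigr => i _.
by rewrite linearZ.
Qed.

Lemma linear_inverse (P Q : lmodType R) (f : {linear P -> Q}) :
  bijective f -> exists g : {linear Q -> P}, cancel f g /\ cancel g f.
Proof.
case=> g fK gK.
have gL : linear g by move=> a x y; apply: (can_inj fK); rewrite linearP !gK.
pose HL := GRing.isLinear.Build R Q P _ g gL.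
by pose g' : {linear Q -> P} := HB.pack g HL; exists g'.
Qed.

Lemma fgproj_retract (P : lmodType R) :
  finitely_generated P -> projective P ->
  exists n (s : {linear P -> 'rV[R]_n}) (q : {linear 'rV[R]_n -> P}), cancel s q.
Proof.
case=> n [g gP] pP; have [|s sP] := pP _ _ (lin_comb g) idfun.
  move=> y; have [c ->] := gP y; exists (\row_i c i).
  by apply: eq_bigr => i _; rewrite mxE.
by exists n, s, (lin_comb g).
Qed.

Lemma retract_fg (P : lmodType R) n (s : {linear P -> 'rV[R]_n})
  (q : {linear 'rV[R]_n -> P}) : cancel s q -> finitely_generated P.
Proof.
move=> sK; exists n, (fun i => q (delta_mx 0 i)) => x; exists (s x 0).
by rewrite -{1}[x]sK lin_combE.
Qed.

Lemma retract_projective (P : lmodType R) n (s : {linear P -> 'rV[R]_n})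
  (q : {linear 'rV[R]_n -> P}) : cancel s q -> projective P.
Proof.
move=> sK M N p f p_surj.
have /choice[c cP] : forall i, exists x, p x = f (q (delta_mx 0 i)).
  by move=> i; apply: p_surj.
exists (lin_comb c \o s) => x /=.
have /= fE := lin_combE (f \o q) (s x); rewrite -[in RHS](sK x) fE.
rewrite /lin_comb linear_sum.
by apply: eq_bigr => i _; rewrite linearZ /= cP.
Qed.

End LinearAux.

Section FreeModule.
Variables (R : pzRingType) (n : nat).

Definition free_sub : {pred 'rV[R]_n} := predT.
Fact free_sub_closed : submod_closed free_sub. Proof. by []. Qed.
HB.instance Definition _ :=
  GRing.isSubmodClosed.Build R 'rV[R]_n free_sub free_sub_closed.

Definition to_free (x : 'rV[R]_n) : submod_of free_sub := Sub x (erefl true).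
Fact to_free_linear : linear to_free.
Proof. by move=> a x y; apply: val_inj. Qed.
HB.instance Definition _ :=
  GRing.isLinear.Build R 'rV[R]_n (submod_of free_sub) _ to_free to_free_linear.

Lemma to_freeK : cancel (\val : submod_of free_sub -> _) to_free.
Proof. by move=> x; apply: val_inj. Qed.

Definition free_mod : fgproj R :=
  FGProj (@retract_fg _ _ _ \val to_free to_freeK)
         (@retract_projective _ _ _ \val to_free to_freeK).

(* M acts on row vectors by right multiplication, which is left R-linear; the
   resulting order of composition is immaterial in the abelian group K1. *)
Definition mulmx_map (M : 'M[R]_n) (x : free_mod) : free_mod :=
  to_free (\val x *m M).
Fact mulmx_map_linear M : linear (mulmx_map M).
Proof.
by move=> a x y; apply: val_inj; rewrite /= mulmxDl scalemxAl.
Qed.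
HB.instance Definition _ M :=
  GRing.isLinear.Build R free_mod free_mod _ (mulmx_map M) (mulmx_map_linear M).

Definition invertible_mx (M : 'M[R]_n) :=
  exists N : 'M[R]_n, M *m N = 1%:M /\ N *m M = 1%:M.

Fact mulmx_map_bij M : invertible_mx M -> bijective (mulmx_map M).
Proof.
by case=> N [MN NM]; exists (mulmx_map N) => x; apply: val_inj;
  rewrite /= -mulmxA ?MN ?NM mulmx1.
Qed.

Definition torsion_mx (M : 'M[R]_n) (hM : invertible_mx M) : K1 R :=
  torsion (FGAut (mulmx_map M) (mulmx_map_bij hM)).

End FreeModule.

Section TorsionIso.
Variable R : pzRingType.

Lemma torsion_id (a : fgaut R) : aut_map a =1 id -> torsion a = 0.
Proof.
case: a => P f bf /= fid; have bff : bijective (f \o f) by exact: bij_comp.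
have := torsion_comp bf bf bff.
rewrite (eq_FGAut bff bf) => [|x /=]; last by rewrite fid.
by move=> /(congr1 (fun t => t - torsion (FGAut f bf))); rewrite subrr addrK.
Qed.

Lemma torsion_iso (a b : fgaut R) (k : {linear aut_mod a -> aut_mod b}) :
  bijective k -> (forall x, k (aut_map a x) = aut_map b (k x)) ->
  torsion a = torsion b.
Proof.
move=> bk kab; have bid : bijective (idfun : free_mod R 0 -> _) by exists id.
pose z := FGAut (aut_mod := free_mod R 0) idfun bid.
have z0 (x : free_mod R 0) : x = 0 by apply: val_inj; apply: thinmx0.
have [k' kK k'K] := bk.
suff -> : torsion b = torsion a + torsion z by rewrite (@torsion_id z) ?addr0.
apply: (@torsion_exact _ a b z k \0) => //; first exact: can_inj kK.
- by move=> x; split=> // _; exists (k' x); rewrite k'K.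
- by move=> x; exists 0; rewrite [x]z0.
Qed.

Lemma fgproj_iso (P : lmodType R) : finitely_generated P -> projective P ->
  exists (Q : fgproj R) (k : {linear P -> Q}), bijective k.
Proof.
move=> fgP pP; have [n [s [q sK]]] := fgproj_retract fgP pP.
pose U : {pred 'rV[R]_n} := fun u => s (q u) == u.
have U_closed : submod_closed U.
  split=> [|a x y]; first by rewrite unfold_in !linear0.
  by rewrite !unfold_in => /eqP xU /eqP yU; rewrite !linearP /= xU yU.
pose HU := GRing.isSubmodClosed.Build R 'rV[R]_n U U_closed.
pose U' : submodClosed 'rV[R]_n := HB.pack U HU.
have sU x : s x \in U' by rewrite unfold_in /= sK.
pose k (x : P) : submod_of U' := Sub (s x) (sU x).
have k_linear : linear k by move=> a x y; apply: val_inj; rewrite /= linearP.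
pose Hk := GRing.isLinear.Build R P (submod_of U') _ k k_linear.
pose k' : {linear P -> submod_of U'} := HB.pack k Hk.
have kK : cancel k (q \o \val) by move=> x; rewrite /= sK.
have kK' : cancel (\val : submod_of U' -> _) (k' \o q).
  by case=> u uU; apply: val_inj; apply/eqP.
exists (FGProj (retract_fg kK') (retract_projective kK')), k'.
by exists (q \o \val).
Qed.

End TorsionIso.

Definition invertible (R : pzRingType) (x : R) :=
  exists y, x * y = 1 /\ y * x = 1.

Fact invertible_mx11 (R : pzRingType) (x : R) :
  invertible x -> invertible_mx (x%:M : 'M[R]_1).
Proof.
by case=> y [xy yx]; exists y%:M; rewrite -!scalar_mxM ?xy ?yx.
Qed.

Definition torsion_unit (R : pzRingType) (x : R) (hx : invertible x) : K1 R :=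
  torsion_mx (invertible_mx11 hx).

Section TorsionUnit.
Variable R : pzRingType.

Lemma torsion_mxM n (M N : 'M[R]_n) (hM : invertible_mx M) (hN : invertible_mx N)
    (hMN : invertible_mx (M *m N)) :
  torsion_mx hMN = torsion_mx hM + torsion_mx hN.
Proof.
have bb : bijective (mulmx_map N \o mulmx_map M).
  by apply: bij_comp; apply: mulmx_map_bij.
rewrite /torsion_mx -(torsion_comp _ _ bb); congr torsion.
by apply: eq_FGAut => x; apply: val_inj; rewrite /= mulmxA.
Qed.

Lemma torsion_mx1 n (M : 'M[R]_n) (hM : invertible_mx M) :
  M = 1%:M -> torsion_mx hM = 0.
Proof.
by move=> M1; apply: torsion_id => x; apply: val_inj; rewrite /= M1 mulmx1.
Qed.

Lemma invertibleM (x y : R) : invertible x -> invertible y -> invertible (x * y).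
Proof.
move=> [x' [xx' x'x]] [y' [yy' y'y]]; exists (y' * x'); split.
  by rewrite mulrA -[x * y * y']mulrA yy' mulr1.
by rewrite mulrA -[y' * x' * x]mulrA x'x mulr1.
Qed.

Lemma torsion_unitM (x y : R) (hx : invertible x) (hy : invertible y)
    (hxy : invertible (x * y)) :
  torsion_unit hxy = torsion_unit hx + torsion_unit hy.
Proof.
have hM : invertible_mx (x%:M *m y%:M : 'M[R]_1).
  by rewrite -scalar_mxM; apply: invertible_mx11.
rewrite /torsion_unit -(torsion_mxM _ _ hM); congr torsion.
by apply: eq_FGAut => z; apply: val_inj; rewrite /= scalar_mxM.
Qed.

Lemma torsion_unit1 (x : R) (hx : invertible x) : x = 1 -> torsion_unit hx = 0.
Proof. by move=> x1; apply: torsion_mx1; rewrite x1. Qed.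
End TorsionUnit.

Section BaseChange.
Variables (R S : pzRingType) (phi : {rmorphism R -> S}).

(* u : P -> Q exhibits Q as the extension of scalars S (x)_R P: every
   phi-semilinear map from P factors uniquely through u. *)
Definition is_base_change (P : lmodType R) (Q : lmodType S)
    (u : {linear P -> Q | phi \; *:%R}) : Prop :=
  forall (N : lmodType S) (h : {linear P -> N | phi \; *:%R}),
    exists2 k : {linear Q -> N}, (forall x, k (u x) = h x) &
      forall k' : {linear Q -> N}, (forall x, k' (u x) = h x) -> k' =1 k.

Section SemiComp.
Variables (P : lmodType R) (Q N : lmodType S).
Variables (k : {linear Q -> N}) (u : {linear P -> Q | phi \; *:%R}).
Definition semi_comp (x : P) : N := k (u x).
Fact semi_comp_linear : linear_for (phi \; *:%R) semi_comp.
Proof. by move=> a x y; rewrite /semi_comp linearD linearZ_LR /= linearD linearZ. Qed.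
HB.instance Definition _ :=
  GRing.isLinear.Build R P N (phi \; *:%R) semi_comp semi_comp_linear.
End SemiComp.

Lemma base_change_ext (P : lmodType R) (Q N : lmodType S)
    (u : {linear P -> Q | phi \; *:%R}) (k k' : {linear Q -> N}) :
  is_base_change u -> (forall x, k (u x) = k' (u x)) -> k =1 k'.
Proof.
move=> bu kk'; have [k0 _ k0P] := bu N (semi_comp k' u).
by move=> y; rewrite (k0P k kk') (k0P k').
Qed.

Section Exists.
Variables (P : lmodType R) (n : nat).
Variables (s : {linear P -> 'rV[R]_n}) (q : {linear 'rV[R]_n -> P}).
Hypothesis sK : cancel s q.
Let e : 'M[R]_n := \matrix_i s (q (delta_mx 0 i)).
Let eE u : u *m e = s (q u).
Proof.
have /= -> := lin_combE (s \o q) u; rewrite mulmx_sum_row.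
by apply: eq_bigr => i _; rewrite rowK.
Qed.
Let E := map_mx phi e.
Definition bc_sub : {pred 'rV[S]_n} := fun y => y *m E == y.
Fact bc_sub_closed : submod_closed bc_sub.
Proof.
split=> [|a x y]; first by rewrite unfold_in mul0mx.
rewrite !unfold_in => /eqP xE /eqP yE.
by rewrite mulmxDl -scalemxAl xE yE.
Qed.
HB.instance Definition _ :=
  GRing.isSubmodClosed.Build S 'rV[S]_n bc_sub bc_sub_closed.
Let Q : lmodType S := submod_of bc_sub.

Let EE : E *m E = E.
Proof.
rewrite -map_mxM; congr map_mx; apply/row_matrixP => i.
by rewrite row_mul eE !rowK sK.
Qed.

Fact bc_proj_in (y : 'rV[S]_n) : y *m E \in bc_sub.
Proof. by rewrite unfold_in -mulmxA EE. Qed.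
Definition bc_proj y : Q := Sub (y *m E) (bc_proj_in y).
Fact bc_proj_linear : linear bc_proj.
Proof. by move=> a x y; apply: val_inj; rewrite /= mulmxDl scalemxAl. Qed.
HB.instance Definition _ :=
  GRing.isLinear.Build S 'rV[S]_n Q _ bc_proj bc_proj_linear.
Fact bc_projK : cancel (\val : Q -> _) bc_proj.
Proof. by case=> x xE; apply: val_inj; apply/eqP. Qed.

Fact bc_unit_in (x : P) : map_mx phi (s x) \in bc_sub.
Proof. by rewrite unfold_in -map_mxM eE sK. Qed.
Definition bc_unit x : Q := Sub (map_mx phi (s x)) (bc_unit_in x).
Fact bc_unit_linear : linear_for (phi \; *:%R) bc_unit.
Proof.
move=> a x y; apply: val_inj; rewrite /= linearP /= map_mxD.
by congr (_ + _); apply/matrixP => i j; rewrite !mxE /= rmorphM.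
Qed.
HB.instance Definition _ :=
  GRing.isLinear.Build R P Q (phi \; *:%R) bc_unit bc_unit_linear.

Let bc_gen (y : Q) : y = lin_comb (fun i => bc_unit (q (delta_mx 0 i))) (\val y).
Proof.
rewrite -{1}[y]bc_projK; apply: val_inj.
rewrite /lin_comb linear_sum [LHS]mulmx_sum_row; apply: eq_bigr => i _.
by rewrite linearZ /=; congr (_ *: _); apply/rowP=> j; rewrite !mxE.
Qed.

Lemma bc_unitP : is_base_change bc_unit.
Proof.
move=> N h; exists (lin_comb (fun i => h (q (delta_mx 0 i))) \o \val).
  move=> x /=; rewrite -[in RHS](sK x) {2}[s x]row_sum_delta !linear_sum.
  apply: eq_bigr => i _; rewrite mxE.
  by rewrite !linearZ_LR /=.
move=> k' k'P y /=; rewrite [y in LHS]bc_gen /lin_comb linear_sum.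
by apply: eq_bigr => i _; rewrite linearZ /= k'P.
Qed.
End Exists.

Lemma base_change_exists (P : fgproj R) :
  exists Q : fgproj S, exists u : {linear P -> Q | phi \; *:%R}, is_base_change u.
Proof.
have [n [s [q sK]]] := fgproj_retract (fgp_fg P) (fgp_proj P).
exists (FGProj (retract_fg (bc_projK sK)) (retract_projective (bc_projK sK))).
by exists (bc_unit sK); exact: bc_unitP.
Qed.

Definition bc_mod (P : fgproj R) : fgproj S := projT1 (cid (base_change_exists P)).
Definition bc_map (P : fgproj R) : {linear P -> bc_mod P | phi \; *:%R} :=
  projT1 (cid (projT2 (cid (base_change_exists P)))).
Lemma bc_mapP (P : fgproj R) : is_base_change (bc_map P).
Proof. exact: (projT2 (cid (projT2 (cid (base_change_exists P))))). Qed.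

Arguments bc_mapP P N h : rename, clear implicits.

Fact bc_lift_exists (P Q : fgproj R) (f : {linear P -> Q}) :
  exists k : {linear bc_mod P -> bc_mod Q},
    forall x, k (bc_map P x) = bc_map Q (f x).
Proof. by have [k kP _] := bc_mapP P _ (bc_map Q \o f); exists k. Qed.
Definition bc_lift (P Q : fgproj R) (f : {linear P -> Q}) :
  {linear bc_mod P -> bc_mod Q} := projT1 (cid (bc_lift_exists f)).
Lemma bc_liftE (P Q : fgproj R) (f : {linear P -> Q}) x :
  bc_lift f (bc_map P x) = bc_map Q (f x).
Proof. exact: (projT2 (cid (bc_lift_exists f))). Qed.

Lemma bc_lift_comp (P Q T : fgproj R) (f : {linear P -> Q}) (g : {linear Q -> T})
    (h : {linear P -> T}) :
  (forall x, g (f x) = h x) -> forall y, bc_lift g (bc_lift f y) = bc_lift h y.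
Proof.
move=> gfh; apply: (base_change_ext (k := bc_lift g \o bc_lift f) (bc_mapP P)).
by move=> x /=; rewrite !bc_liftE gfh.
Qed.

Lemma bc_lift_id (P : fgproj R) (f : {linear P -> P}) :
  f =1 id -> bc_lift f =1 id.
Proof.
move=> fid; apply: (base_change_ext (k' := idfun) (bc_mapP P)) => x.
by rewrite bc_liftE fid.
Qed.

Fact bc_lift_bij (P : fgproj R) (f : {linear P -> P}) :
  bijective f -> bijective (bc_lift f).
Proof.
move=> /linear_inverse[g [fK gK]]; exists (bc_lift g) => y.
- by rewrite (@bc_lift_comp _ _ _ f g idfun) ?bc_lift_id.
- by rewrite (@bc_lift_comp _ _ _ g f idfun) ?bc_lift_id.
Qed.

Definition bc_aut (a : fgaut R) : fgaut S :=
  FGAut (bc_lift (aut_map a)) (bc_lift_bij (aut_bij a)).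

Fact bc_aut_comp (P : fgproj R) (f g : {linear P -> P})
    (bf : bijective f) (bg : bijective g) (bgf : bijective (g \o f)) :
  torsion (bc_aut (FGAut (g \o f) bgf)) =
  torsion (bc_aut (FGAut f bf)) + torsion (bc_aut (FGAut g bg)).
Proof.
have bgf' : bijective (bc_lift g \o bc_lift f).
  by apply: bij_comp; apply: bc_lift_bij.
rewrite -(torsion_comp _ _ bgf'); congr torsion; apply: eq_FGAut => y /=.
by rewrite (bc_lift_comp (h := g \o f)).
Qed.

Lemma split_exact (P Q T : lmodType R) (i : {linear P -> Q}) (j : {linear Q -> T}) :
  projective T -> injective i -> (forall x, j x = 0 <-> exists y, i y = x) ->
  (forall z, exists x, j x = z) ->
  exists (t : {linear Q -> P}) (r : {linear T -> Q}),
    [/\ cancel i t, cancel r j & forall x, i (t x) = x - r (j x)].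
Proof.
move=> pT inj_i ex_ij surj_j; have [r rK] := pT _ _ j idfun surj_j.
have /choice[t tE] x : exists y, i y = x - r (j x).
  by apply/ex_ij; rewrite linearB /= rK subrr.
have tL : linear t.
  move=> a x y; apply: inj_i; rewrite linearP !tE !linearP /=.
  by rewrite scalerBr scalerN addrACA.
pose HL := GRing.isLinear.Build R Q P _ t tL.
pose t' : {linear Q -> P} := HB.pack t HL.
exists t', r; split => // x; apply: inj_i; rewrite /= tE.
have -> : j (i x) = 0 by apply/ex_ij; exists x.
by rewrite linear0 subr0.
Qed.

Fact bc_aut_exact (a b c : fgaut R) (i : {linear aut_mod a -> aut_mod b})
    (j : {linear aut_mod b -> aut_mod c}) :
  injective i -> (forall x, j x = 0 <-> exists y, i y = x) ->
  (forall z, exists x, j x = z) ->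
  (forall x, i (aut_map a x) = aut_map b (i x)) ->
  (forall x, j (aut_map b x) = aut_map c (j x)) ->
  torsion (bc_aut b) = torsion (bc_aut a) + torsion (bc_aut c).
Proof.
move=> inj_i ex_ij surj_j iab jbc.
have [t [r [iK rK itE]]] := split_exact (@fgp_proj _ _) inj_i ex_ij surj_j.
have ji0 x : j (i x) = 0 by apply/ex_ij; exists x.
have iK' : cancel (bc_lift i) (bc_lift t).
  by move=> x; rewrite (@bc_lift_comp _ _ _ i t idfun) ?bc_lift_id.
have rK' : cancel (bc_lift r) (bc_lift j).
  by move=> x; rewrite (@bc_lift_comp _ _ _ r j idfun) ?bc_lift_id.
have itE' : forall y,
    bc_lift i (bc_lift t y) = y - bc_lift r (bc_lift j y).
  pose k : {linear _ -> bc_mod (aut_mod b)} := bc_lift i \o bc_lift t.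
  pose k' : {linear _ -> bc_mod (aut_mod b)} :=
    idfun \- (bc_lift r \o bc_lift j).
  apply: (base_change_ext (k := k) (k' := k') (bc_mapP _)) => x /=.
  by rewrite !bc_liftE itE linearB.
have ji0' : forall y, bc_lift j (bc_lift i y) = 0.
  pose k : {linear _ -> bc_mod (aut_mod c)} := bc_lift j \o bc_lift i.
  apply: (base_change_ext (k := k) (k' := \0) (bc_mapP _)) => x /=.
  by rewrite !bc_liftE ji0 linear0.
apply: (@torsion_exact _ (bc_aut a) (bc_aut b) (bc_aut c) (bc_lift i) (bc_lift j)).
- exact: can_inj iK'.
- move=> x; split=> [jx0|[y <-] //].
  by exists (bc_lift t x); rewrite itE' jx0 linear0 subr0.
- by move=> z; exists (bc_lift r z).
- move=> x; rewrite (@bc_lift_comp _ _ _ _ _ (i \o aut_map a)) //.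
  by rewrite (@bc_lift_comp _ _ _ _ _ (i \o aut_map a)) // => {}x /=.
- move=> x; rewrite (@bc_lift_comp _ _ _ _ _ (j \o aut_map b)) //.
  by rewrite (@bc_lift_comp _ _ _ _ _ (j \o aut_map b)) // => {}x /=.
Qed.

(* The homomorphism induced by extension of scalars along phi. By K1_mapE its
   value on tau(P, f) may be computed with any model of S (x)_R P. *)
Definition K1_map : {additive K1 R -> K1 S} :=
  projT1 (cid (k1_lift_exists bc_aut_comp bc_aut_exact)).

Lemma K1_map_bc a : K1_map (torsion a) = torsion (bc_aut a).
Proof. exact: (projT2 (cid (k1_lift_exists bc_aut_comp bc_aut_exact))). Qed.

Lemma K1_mapE (a : fgaut R) (b : fgaut S)
    (u : {linear aut_mod a -> aut_mod b | phi \; *:%R}) :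
  is_base_change u -> (forall x, aut_map b (u x) = u (aut_map a x)) ->
  K1_map (torsion a) = torsion b.
Proof.
move=> bu ub; rewrite K1_map_bc.
have [k kP _] := bc_mapP _ _ u; have [k' k'P _] := bu _ (bc_map (aut_mod a)).
apply: torsion_iso (k : {linear aut_mod (bc_aut a) -> aut_mod b}) _ _.
  exists k'.
    apply: (base_change_ext (k := k' \o k) (k' := idfun) (bc_mapP _)) => x /=.
    by rewrite kP k'P.
  by apply: (base_change_ext (k := k \o k') (k' := idfun) bu) => x /=; rewrite k'P kP.
apply: (base_change_ext (k := k \o bc_lift (aut_map a)) (k' := aut_map b \o k) (bc_mapP _)) => x /=.
by rewrite bc_liftE !kP ub.
Qed.

End BaseChange.

Record ring_aut (A : pzRingType) := RingAut {
  raut :> {rmorphism A -> A};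
  raut_inv : A -> A;
  rautK : cancel raut raut_inv;
  raut_invK : cancel raut_inv raut }.

(* f : pseries rho stands for sum_{j >= 0} f_j z^j and f : laurent rho for
   sum_{j in Z} f_j z^j, with the coefficients written to the left of z^j. The
   parameter rho only enters through the multiplication. *)
Record pseries (A : pzRingType) (rho : ring_aut A) := PSeries {
  pscoef :> nat -> A }.
Arguments PSeries {A rho} _.

Record laurent (A : pzRingType) (rho : ring_aut A) := Laurent {
  lcoef :> int -> A;
  lcoef_bounded : exists N : nat, forall j : int, j < - N%:Z -> lcoef j = 0 }.
Arguments Laurent {A rho} _ _.

Section Series.
Variables (A : pzRingType) (rho : ring_aut A).
Local Notation pseries := (pseries rho).
Local Notation laurent := (laurent rho).

(* a z = z rho(a) gives z^i a = rho^{-i}(a) z^i; ztwist i is rho^{-i}. *)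
Definition ztwist (i : int) (a : A) : A :=
  match i with
  | Posz n => iter n (raut_inv rho) a
  | Negz n => iter n.+1 rho a
  end.

Lemma ztwist0 a : ztwist 0 a = a. Proof. by []. Qed.

Lemma ztwistS i a : ztwist (i + 1) a = raut_inv rho (ztwist i a).
Proof.
case: i => [n|[|n]].
- by have -> : n%:Z + 1 = n.+1 by lia.
- have -> : Negz 0 + 1 = 0 by lia.
  by rewrite /= rautK.
have -> : Negz n.+1 + 1 = Negz n by lia.
by rewrite [in RHS]/= rautK.
Qed.

Lemma ztwistP i a : ztwist (i - 1) a = rho (ztwist i a).
Proof. by rewrite -[in RHS](subrK 1 i) ztwistS raut_invK. Qed.

Lemma ztwistD i j a : ztwist (i + j) a = ztwist i (ztwist j a).
Proof.
elim/int_rect: i => [|n IHn|n IHn]; first by rewrite add0r.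
  have -> : n.+1%:Z + j = (n%:Z + j) + 1 by lia.
  have -> : n.+1%:Z = n%:Z + 1 by lia.
  by rewrite !ztwistS IHn.
have -> : - n.+1%:Z + j = (- n%:Z + j) - 1 by lia.
have -> : - n.+1%:Z = - n%:Z - 1 by lia.
by rewrite !ztwistP IHn.
Qed.

Lemma ztwistK i : cancel (ztwist i) (ztwist (- i)).
Proof. by move=> a; rewrite -ztwistD addNr. Qed.

Fact raut_inv_zmod : zmod_morphism (raut_inv rho).
Proof. by move=> a b; apply: (can_inj (rautK rho)); rewrite rmorphB !raut_invK. Qed.
Fact raut_inv_monoid : monoid_morphism (raut_inv rho).
Proof.
split; first by rewrite -[LHS](congr1 _ (rmorph1 rho)) rautK.
by move=> a b; apply: (can_inj (rautK rho)); rewrite rmorphM !raut_invK.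
Qed.

Fact ztwist_zmod i : zmod_morphism (ztwist i).
Proof.
case: i => n a b /=; elim: n => [|n IHn] //=; first by rewrite IHn raut_inv_zmod.
  by rewrite rmorphB.
by rewrite IHn rmorphB.
Qed.
Fact ztwist_monoid i : monoid_morphism (ztwist i).
Proof.
split; first by case: i => n /=; elim: n => [|n IHn] //=;
  rewrite ?IHn ?rmorph1 ?raut_inv_monoid.
case: i => n a b /=; elim: n => [|n IHn] //=; first by rewrite IHn raut_inv_monoid.
  by rewrite rmorphM.
by rewrite IHn rmorphM.
Qed.
HB.instance Definition _ i := GRing.isZmodMorphism.Build A A (ztwist i) (ztwist_zmod i).
HB.instance Definition _ i := GRing.isMonoidMorphism.Build A A (ztwist i) (ztwist_monoid i).

Definition window (B : nat) : seq int := [seq k%:Z - B%:Z | k <- iota 0 B.*2.+1].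
Lemma window_uniq B : uniq (window B).
Proof. by rewrite map_inj_uniq ?iota_uniq // => i j; lia. Qed.
Lemma mem_window B i : (`|i| <= B)%N -> i \in window B.
Proof.
move=> iB; apply/mapP; exists (absz (i + B%:Z)); last by lia.
by rewrite mem_iota; lia.
Qed.

Lemma fsum_seq (s : seq int) (F : int -> A) :
  uniq s -> (forall i, i \notin s -> F i = 0) ->
  \sum_(i \in setT) F i = \sum_(i <- s) F i.
Proof.
move=> us Fs; rewrite (fsbigE s) // => [|i _ /Fs //].
by apply: eq_bigl => i; rewrite in_setT.
Qed.

Lemma fsum_window (B : nat) (F : int -> A) :
  (forall i, (B < `|i|)%N -> F i = 0) ->
  \sum_(i \in setT) F i = \sum_(i <- window B) F i.
Proof.
move=> FB; apply: fsum_seq; first exact: window_uniq.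
by move=> i; apply: contraNeq => Fi; apply: mem_window; rewrite leqNgt;
  apply: contra_neqN Fi => /FB.
Qed.

Lemma laurent_ext (f g : laurent) : f =1 g -> f = g.
Proof.
case: f g => f bf [g bg] /= /funext fg; case: _ / fg in bg *.
by congr Laurent; exact: Prop_irrelevance.
Qed.

HB.instance Definition _ := gen_eqMixin laurent.
HB.instance Definition _ := gen_choiceMixin laurent.

Fact lzero_bounded : exists N : nat, forall j : int, j < - N%:Z -> (0 : A) = 0.
Proof. by exists 0. Qed.
Definition lzero : laurent := Laurent _ lzero_bounded.

Fact lopp_bounded (f : laurent) :
  exists N : nat, forall j : int, j < - N%:Z -> - f j = 0.
Proof.
by have [N fN] := lcoef_bounded f; exists N => j /fN ->; rewrite oppr0.
Qed.
Definition lopp (f : laurent) : laurent := Laurent _ (lopp_bounded f).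

Fact ladd_bounded (f g : laurent) :
  exists N : nat, forall j : int, j < - N%:Z -> f j + g j = 0.
Proof.
have [M fM] := lcoef_bounded f; have [N gN] := lcoef_bounded g.
by exists (M + N)%N => j jMN; rewrite fM ?gN ?addr0 //; lia.
Qed.
Definition ladd (f g : laurent) : laurent := Laurent _ (ladd_bounded f g).

Fact laddA : associative ladd.
Proof. by move=> f g h; apply: laurent_ext => j /=; rewrite addrA. Qed.
Fact laddC : commutative ladd.
Proof. by move=> f g; apply: laurent_ext => j /=; rewrite addrC. Qed.
Fact ladd0 : left_id lzero ladd.
Proof. by move=> f; apply: laurent_ext => j /=; rewrite add0r. Qed.
Fact laddN : left_inverse lzero lopp ladd.
Proof. by move=> f; apply: laurent_ext => j /=; rewrite addNr. Qed.
HB.instance Definition _ := GRing.isZmodule.Build laurent laddA laddC ladd0 laddN.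

(* The sum has finite support by lmul_coefE; the finite-support sum over setT
   is 0 by convention otherwise. *)
Definition lmul_coef (f g : laurent) (k : int) : A :=
  \sum_(i \in setT) f i * ztwist i (g (k - i)).

Lemma lmul_coefE (f g : laurent) (M N B : nat) k :
  (forall j : int, j < - M%:Z -> f j = 0) ->
  (forall j : int, j < - N%:Z -> g j = 0) ->
  (M + N + `|k| <= B)%N ->
  lmul_coef f g k = \sum_(i <- window B) f i * ztwist i (g (k - i)).
Proof.
move=> fM gN hB; apply: fsum_window => i Bi.
have [iM|iM] := ltP i (- M%:Z); first by rewrite fM // mul0r.
by rewrite gN ?rmorph0 ?mulr0 //; lia.
Qed.

Lemma lmul_bound (f g : laurent) (M N : nat) :
  (forall j : int, j < - M%:Z -> f j = 0) ->
  (forall j : int, j < - N%:Z -> g j = 0) ->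
  forall j : int, j < - (M + N)%:Z -> lmul_coef f g j = 0.
Proof.
move=> fM gN j jMN; rewrite (lmul_coefE fM gN (leqnn _)) big1 // => i _.
have [iM|iM] := ltP i (- M%:Z); first by rewrite fM // mul0r.
by rewrite gN ?rmorph0 ?mulr0 //; lia.
Qed.

Fact lmul_bounded (f g : laurent) :
  exists N : nat, forall j : int, j < - N%:Z -> lmul_coef f g j = 0.
Proof.
have [M fM] := lcoef_bounded f; have [N gN] := lcoef_bounded g.
by exists (M + N)%N; exact: lmul_bound.
Qed.
Definition lmul (f g : laurent) : laurent := Laurent _ (lmul_bounded f g).

Fact lmono_bounded (a : A) (n : int) :
  exists N : nat, forall j : int, j < - N%:Z -> (if j == n then a else 0) = 0.
Proof. by exists `|n|%N => j jn; case: eqP => // ?; lia. Qed.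
Definition lmono (a : A) (n : int) : laurent := Laurent _ (lmono_bounded a n).

Lemma lmonoM a i b j : lmul (lmono a i) (lmono b j) = lmono (a * ztwist i b) (i + j).
Proof.
apply: laurent_ext => k /=; rewrite /lmul_coef (@fsum_seq [:: i]) //=.
  rewrite big_seq1 eqxx; have -> : (k - i == j) = (k == i + j) by lia.
  by case: eqP => // _; rewrite rmorph0 mulr0.
by move=> l; rewrite inE => /negPf ->; rewrite mul0r.
Qed.

Fact lmul1 : left_id (lmono 1 0) lmul.
Proof.
move=> f; apply: laurent_ext => k /=; rewrite /lmul_coef (@fsum_seq [:: 0]) //=.
  by rewrite big_seq1 eqxx mul1r subr0.
by move=> l; rewrite inE => /negPf ->; rewrite mul0r.
Qed.
Fact lmulr1 : right_id (lmono 1 0) lmul.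
Proof.
move=> f; apply: laurent_ext => k /=; rewrite /lmul_coef (@fsum_seq [:: k]) //=.
  by rewrite big_seq1 subrr eqxx rmorph1 mulr1.
move=> l; rewrite inE => lk; have -> : (k - l == 0) = false by lia.
by rewrite rmorph0 mulr0.
Qed.
Fact lmulDl : left_distributive lmul +%R.
Proof.
move=> f g h; apply: laurent_ext => k /=.
have [L fL] := lcoef_bounded f; have [M gM] := lcoef_bounded g.
have [N hN] := lcoef_bounded h.
have fgLM : forall j : int, j < - (L + M)%:Z -> (f + g : laurent) j = 0.
  by move=> j jLM /=; rewrite fL ?gM ?addr0 //; lia.
pose B := (L + M + N + `|k|)%N.
rewrite (@lmul_coefE _ _ _ _ B _ fgLM hN) ?(@lmul_coefE _ _ _ _ B _ fL hN)
  ?(@lmul_coefE _ _ _ _ B _ gM hN); [|lia..].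
by rewrite -big_split; apply: eq_bigr => i _ /=; rewrite mulrDl.
Qed.
Fact lmulDr : right_distributive lmul +%R.
Proof.
move=> h f g; apply: laurent_ext => k /=.
have [L fL] := lcoef_bounded f; have [M gM] := lcoef_bounded g.
have [N hN] := lcoef_bounded h.
have fgLM : forall j : int, j < - (L + M)%:Z -> (f + g : laurent) j = 0.
  by move=> j jLM /=; rewrite fL ?gM ?addr0 //; lia.
pose B := (L + M + N + `|k|)%N.
rewrite (@lmul_coefE _ _ _ _ B _ hN fgLM) ?(@lmul_coefE _ _ _ _ B _ hN fL)
  ?(@lmul_coefE _ _ _ _ B _ hN gM); [|lia..].
by rewrite -big_split; apply: eq_bigr => i _ /=; rewrite rmorphD mulrDr.
Qed.
Fact lmulA : associative lmul.
Proof.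
move=> f g h; apply: laurent_ext => k /=.
have [M fM] := lcoef_bounded f; have [N gN] := lcoef_bounded g.
have [L hL] := lcoef_bounded h.
pose B1 := (M + N + L + `|k|)%N; pose B2 := (M + N + B1)%N.
have fgMN := lmul_bound fM gN; have ghNL := lmul_bound gN hL.
rewrite (@lmul_coefE f (lmul g h) _ _ B2 _ fM ghNL); last by lia.
rewrite (@lmul_coefE (lmul f g) h _ _ B1 _ fgMN hL); last by lia.
transitivity (\sum_(i <- window B2) \sum_(j <- window B1)
   f i * ztwist i (g (j - i)) * ztwist j (h (k - j))).
  apply: eq_bigr => i _ /=.
  have [iM|iM] := ltP i (- M%:Z).
    by rewrite fM // mul0r big1 // => j _; rewrite !mul0r.
  rewrite /lmul_coef (reindex_fsbigT (fun j : int => j - i)); last first.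
    by exists (fun j => j + i) => j; rewrite ?subrK ?addrK.
  rewrite (@fsum_window B1) => [|j Bj].
    rewrite rmorph_sum mulr_sumr; apply: eq_bigr => j _.
    rewrite rmorphM /= -ztwistD mulrA.
    have -> : i + (j - i) = j by lia.
    by have -> : k - i - (j - i) = k - j by lia.
  have [jN|jN] := ltP (j - i) (- N%:Z); first by rewrite gN // mul0r.
  by rewrite hL ?rmorph0 ?mulr0 //; lia.
rewrite exchange_big /=; apply: eq_big_seq => j jB.
rewrite (@lmul_coefE f g _ _ B2 _ fM gN) ?mulr_suml //.
by move/mapP: jB => [x]; rewrite mem_iota; lia.
Qed.
HB.instance Definition _ := GRing.Zmodule_isPzRing.Build laurent
  lmulA lmul1 lmulr1 lmulDl lmulDr.


Lemma pseries_ext (f g : pseries) : f =1 g -> f = g.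
Proof. by case: f g => f [g] /= /funext ->. Qed.

HB.instance Definition _ := gen_eqMixin pseries.
HB.instance Definition _ := gen_choiceMixin pseries.

Definition psadd (f g : pseries) : pseries := PSeries (fun n => f n + g n).
Definition psopp (f : pseries) : pseries := PSeries (fun n => - f n).
Definition psone : pseries := PSeries (fun n => if n == 0%N then 1 else 0).
Definition psmul (f g : pseries) : pseries :=
  PSeries (fun n => \sum_(i < n.+1) f i * ztwist i%:Z (g (n - i)%N)).

Fact psaddA : associative psadd.
Proof. by move=> f g h; apply: pseries_ext => j /=; rewrite addrA. Qed.
Fact psaddC : commutative psadd.
Proof. by move=> f g; apply: pseries_ext => j /=; rewrite addrC. Qed.
Fact psadd0 : left_id (PSeries (fun=> 0)) psadd.
Proof. by move=> f; apply: pseries_ext => j /=; rewrite add0r. Qed.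
Fact psaddN : left_inverse (PSeries (fun=> 0)) psopp psadd.
Proof. by move=> f; apply: pseries_ext => j /=; rewrite addNr. Qed.
HB.instance Definition _ :=
  GRing.isZmodule.Build pseries psaddA psaddC psadd0 psaddN.

Fact laurent_of_pseries_bounded (f : pseries) :
  exists N : nat, forall j : int, j < - N%:Z ->
    (if j is Posz n then f n else 0) = 0.
Proof. by exists 0 => -[n|n]. Qed.
Definition laurent_of_pseries (f : pseries) : laurent :=
  Laurent _ (laurent_of_pseries_bounded f).

Lemma laurent_of_pseries_inj : injective laurent_of_pseries.
Proof.
move=> f g fg; apply: pseries_ext => n.
by have := congr1 (fun h : laurent => h n) fg.
Qed.

Fact laurent_of_pseriesB : zmod_morphism laurent_of_pseries.
Proof. by move=> f g; apply: laurent_ext => -[n|n] //=; rewrite subrr. Qed.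
Fact laurent_of_pseries1 : laurent_of_pseries psone = 1.
Proof. by apply: laurent_ext => -[n|n]. Qed.
Fact laurent_of_pseriesM (f g : pseries) :
  laurent_of_pseries (psmul f g) = laurent_of_pseries f * laurent_of_pseries g.
Proof.
apply: laurent_ext => -[n|n].
- rewrite /= /lmul_coef (@fsum_seq [seq Posz k | k <- iota 0 n.+1]); first last.
  + move=> [i|i]; last by rewrite /= mul0r.
    rewrite mem_map; last by move=> ? ? [].
    rewrite mem_iota => ni; have -> : n%:Z - i%:Z = Negz (i - n.+1) by lia.
    by rewrite rmorph0 mulr0.
  + by rewrite map_inj_uniq ?iota_uniq // => ? ? [].
  rewrite big_map -[iota _ _]/(index_iota 0 n.+1) big_mkord.
  apply: eq_bigr => i _ /=.
  by have -> : n%:Z - i%:Z = (n - i)%N by have := ltn_ord i; lia.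
- rewrite /= /lmul_coef (@fsum_seq [::]) ?big_nil // => -[i|i] _;
    last by rewrite /= mul0r.
  have -> : Negz n - i%:Z = Negz (n + i) by lia.
  by rewrite rmorph0 mulr0.
Qed.

Fact psmulA : associative psmul.
Proof.
by move=> f g h; apply: laurent_of_pseries_inj;
  rewrite !laurent_of_pseriesM mulrA.
Qed.
Fact psmul1 : left_id psone psmul.
Proof.
by move=> f; apply: laurent_of_pseries_inj;
  rewrite laurent_of_pseriesM laurent_of_pseries1 mul1r.
Qed.
Fact psmulr1 : right_id psone psmul.
Proof.
by move=> f; apply: laurent_of_pseries_inj;
  rewrite laurent_of_pseriesM laurent_of_pseries1 mulr1.
Qed.
Fact laurent_of_pseriesD f g :
  laurent_of_pseries (psadd f g) = laurent_of_pseries f + laurent_of_pseries g.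
Proof. by apply: laurent_ext => -[n|n] //=; rewrite addr0. Qed.
Fact psmulDl : left_distributive psmul +%R.
Proof.
by move=> f g h; apply: laurent_of_pseries_inj;
  rewrite laurent_of_pseriesM !laurent_of_pseriesD !laurent_of_pseriesM mulrDl.
Qed.
Fact psmulDr : right_distributive psmul +%R.
Proof.
by move=> f g h; apply: laurent_of_pseries_inj;
  rewrite laurent_of_pseriesM !laurent_of_pseriesD !laurent_of_pseriesM mulrDr.
Qed.
HB.instance Definition _ := GRing.Zmodule_isPzRing.Build pseries
  psmulA psmul1 psmulr1 psmulDl psmulDr.

HB.instance Definition _ := GRing.isZmodMorphism.Build pseries laurent
  laurent_of_pseries laurent_of_pseriesB.
Fact laurent_of_pseries_monoid : monoid_morphism laurent_of_pseries.
Proof. by split; [exact: laurent_of_pseries1 | exact: laurent_of_pseriesM]. Qed.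
HB.instance Definition _ := GRing.isMonoidMorphism.Build pseries laurent
  laurent_of_pseries laurent_of_pseries_monoid.

Definition laurent_const (a : A) : laurent := lmono a 0.
Fact laurent_const_zmod : zmod_morphism laurent_const.
Proof. by move=> a b; apply: laurent_ext => j /=; case: eqP; rewrite ?subr0. Qed.
HB.instance Definition _ := GRing.isZmodMorphism.Build A laurent
  laurent_const laurent_const_zmod.
Fact laurent_const_monoid : monoid_morphism laurent_const.
Proof. by split=> // a b; rewrite [RHS]lmonoM. Qed.
HB.instance Definition _ := GRing.isMonoidMorphism.Build A laurent
  laurent_const laurent_const_monoid.

Definition laurent_z : laurent := lmono 1 1.

Lemma laurent_const_z a : laurent_const a * laurent_z = laurent_z * laurent_const (rho a).
Proof.
rewrite [LHS]lmonoM [RHS]lmonoM /= rautK mulr1 mul1r.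
by congr lmono; lia.
Qed.

Fact laurent_z_invertible : invertible laurent_z.
Proof.
exists (lmono 1 (-1)); split; rewrite [LHS]lmonoM rmorph1 mulr1;
  by congr lmono; lia.
Qed.

End Series.

Section WittVectors.
Variables (A : pzRingType) (rho : ring_aut A).

Definition witt_torsions : {pred K1 (pseries rho)} := fun x =>
  `[< exists (w : pseries rho) (hw : invertible w),
        w 0%N = 1 /\ x = torsion_unit hw >].

Fact witt_torsions_zmod_closed : zmod_closed witt_torsions.
Proof.
split=> [|_ _ /asboolP[w [hw [w0 ->]]] /asboolP[v [hv [v0 ->]]]]; apply/asboolP.
  have h1 : invertible (1 : pseries rho) by exists 1; rewrite mulr1.
  by exists 1, h1; rewrite torsion_unit1.
have [u [vu uv]] := hv; have hu : invertible u by exists v.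
have u0 : u 0%N = 1.
  have := congr1 (fun f : pseries rho => f 0%N) vu.
  by rewrite /= big_ord1 v0 mul1r subn0.
have hwu := invertibleM hw hu; exists (w * u), hwu; split.
  by rewrite /= big_ord1 w0 mul1r subn0 u0.
rewrite (torsion_unitM hw hu) -[torsion_unit hu](addrK (torsion_unit hv)).
have huv := invertibleM hu hv; rewrite -(torsion_unitM hu hv huv).
by rewrite (torsion_unit1 huv uv) sub0r.
Qed.
HB.instance Definition _ :=
  GRing.isZmodClosed.Build _ witt_torsions witt_torsions_zmod_closed.

Definition W1 := {x : K1 (pseries rho) | x \in witt_torsions}.
HB.instance Definition _ := SubType.on W1.
HB.instance Definition _ := Choice.on W1.
HB.instance Definition _ := [SubChoice_isSubZmodule of W1 by <:].

Definition C2hat : {additive W1 -> K1 (laurent rho)} :=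
  K1_map (laurent_of_pseries (rho := rho)) \o \val.

End WittVectors.

(* Main.v *)
From HB Require Import structures.
Require Import Defs.
From mathcomp Require Import all_boot all_order all_algebra zify.
From mathcomp Require Import boolp freeg.

Set Implicit Arguments.
Unset Strict Implicit.
Unset Printing Implicit Defensive.

Import Order.TTheory GRing.Theory Num.Theory.
Local Open Scope ring_scope.

(** The left inverse is a determinant of commutators of infinite matrices. Let S
    be A_rho[[t]], a copy of A_rho[[z]] in another variable, and extend rho to S
    by rho(t) = t; then t z^-1 is a central element of S_rho((z)). On row vectors
    over S_rho((z)) let T be multiplication by t z^-1 followed by truncation of
    the negative powers of z, and let G = 1 - T, an invertible S-linear operator
    ([shift], [resolvent]). A matrix M in GL_n(A_rho((z))) acts on row vectors
    from the right. It commutes with multiplication by t z^-1, but not with the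
    truncation, and the commutator
      X_M = M^-1 G M G^-1   (maps composed from left to right)
    measures the failure. Far enough in the z-adic filtration there is nothing to
    truncate, so X_M is the identity on a lattice z^hi S_rho[[z]]^n; and X_M - 1
    has image in a lattice z^lo S_rho[[z]]^n ([commutator_op_tame]). Hence X_M acts
    on the finite free S-module z^lo / z^hi, by a matrix that is 1 modulo t. The
    torsion of that matrix in K_1(S) is the value of the left inverse at tau(M).

    That this is well defined and multiplicative rests on the single identity
    tau(1 + U V) = tau(1 + V U) ([gl_torsion_1addC]). Applied to maps between
    different windows z^lo / z^hi ([window_mx_cyclic]) it shows that the torsion
    does not depend on the window, does not change when X_M is conjugated by an
    element of GL_n(A_rho((z))), and does not change when M is enlarged by an
    identity block. As X_(M N) = (N^-1 X_M N) X_N, it is therefore multiplicative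
    in M ([commutator_torsionM]).

    The value lies in W_1 because a matrix over S that is 1 modulo t can be
    brought to triangular form by Gaussian elimination, with Witt vectors as
    pivots ([witt_mx_torsion]). For a Witt vector w the window z^0 / z^1 suffices,
    and there X_w is multiplication by w(t) ([commutator_torsion_witt]): this is
    the left inverse property. Matrices over A commute with truncation, so that
    X_M = 1, and X_z is unipotent.

    As K_1 is generated by automorphisms of all finitely generated projective
    modules, it remains to pass from matrices to these: a stable family of
    homomorphisms on the groups GL_n extends to K_1 ([K1_functional]), because an
    automorphism of a retract of R^n can be extended by the identity to R^n. *)

(** * Torsions of matrices *)

Section InvertibleMatrices.
Variable R : pzRingType.

Lemma invertible_mx1 n : invertible_mx (1%:M : 'M[R]_n).
Proof. by exists 1%:M; rewrite mulmx1. Qed.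

Lemma invertible_mxM n (M N : 'M[R]_n) :
  invertible_mx M -> invertible_mx N -> invertible_mx (M *m N).
Proof.
move=> [M' [MM' M'M]] [N' [NN' N'N]]; exists (N' *m M'); split.
  by rewrite mulmxA -[M *m N *m N']mulmxA NN' mulmx1.
by rewrite mulmxA -[N' *m M' *m M]mulmxA M'M mulmx1.
Qed.

Lemma invertible_mx_ublock m n (M : 'M[R]_m) B (N : 'M[R]_n) :
  invertible_mx M -> invertible_mx N -> invertible_mx (block_mx M B 0 N).
Proof.
move=> [M' [MM' M'M]] [N' [NN' N'N]].
exists (block_mx M' (- (M' *m B *m N')) 0 N'); split;
  rewrite mulmx_block !(mul0mx, mulmx0, addr0, add0r) ?MM' ?M'M ?NN' ?N'N
          scalar_mx_block.
  by rewrite mulmxN !mulmxA MM' mul1mx addNr.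
by rewrite mulNmx -!mulmxA N'N mulmx1 subrr.
Qed.

Lemma invertible_mx_lblock m n (M : 'M[R]_m) C (N : 'M[R]_n) :
  invertible_mx M -> invertible_mx N -> invertible_mx (block_mx M 0 C N).
Proof.
move=> [M' [MM' M'M]] [N' [NN' N'N]].
exists (block_mx M' 0 (- (N' *m C *m M')) N'); split;
  rewrite mulmx_block !(mul0mx, mulmx0, addr0, add0r) ?MM' ?M'M ?NN' ?N'N
          scalar_mx_block.
  by rewrite mulmxN !mulmxA NN' mul1mx subrr.
by rewrite mulNmx -!mulmxA M'M mulmx1 addNr.
Qed.

Lemma invertible_mx_map (S : pzRingType) (phi : {rmorphism R -> S}) n
    (M : 'M[R]_n) :
  invertible_mx M -> invertible_mx (map_mx phi M).
Proof.
by case=> N [MN NM]; exists (map_mx phi N); rewrite -!map_mxM MN NM !map_mx1.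
Qed.

End InvertibleMatrices.

(** [torsion_exact] with the modules as separate arguments rather than as
    projections of automorphisms, for use with explicit [i] and [j]. *)
Lemma torsion_exact_map (R : pzRingType) (P Q T : fgproj R)
    (f : {linear P -> P}) (g : {linear Q -> Q}) (h : {linear T -> T})
    (bf : bijective f) (bg : bijective g) (bh : bijective h)
    (i : {linear P -> Q}) (j : {linear Q -> T}) :
  injective i -> (forall x, j x = 0 <-> exists y, i y = x) ->
  (forall z, exists x, j x = z) ->
  (forall x, i (f x) = g (i x)) -> (forall x, j (g x) = h (j x)) ->
  torsion (FGAut g bg) = torsion (FGAut f bf) + torsion (FGAut h bh).
Proof.
exact: (@torsion_exact R (FGAut f bf) (FGAut g bg) (FGAut h bh) i j).
Qed.

Section GLTorsion.
Variable R : pzRingType.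

(** The torsion as a function of the matrix alone: equal matrices then have equal
    torsions, with no proof of invertibility to transport. *)
Definition gl_torsion n (M : 'M[R]_n) : K1 R :=
  if pselect (invertible_mx M) is left hM then torsion_mx hM else 0.

Lemma gl_torsionE n (M : 'M[R]_n) (hM : invertible_mx M) :
  gl_torsion M = torsion_mx hM.
Proof.
by rewrite /gl_torsion; case: pselect => // h; rewrite (Prop_irrelevance h hM).
Qed.

Lemma gl_torsionM n (M N : 'M[R]_n) : invertible_mx M -> invertible_mx N ->
  gl_torsion (M *m N) = gl_torsion M + gl_torsion N.
Proof.
move=> hM hN; have hMN := invertible_mxM hM hN.
by rewrite !gl_torsionE (torsion_mxM hM hN hMN).
Qed.

Lemma gl_torsion1 n : gl_torsion (1%:M : 'M[R]_n) = 0.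
Proof. by rewrite (gl_torsionE (invertible_mx1 R n)) torsion_mx1. Qed.

Lemma gl_torsion_lblock m n (M : 'M[R]_m) C (N : 'M[R]_n) :
  invertible_mx M -> invertible_mx N ->
  gl_torsion (block_mx M 0 C N) = gl_torsion M + gl_torsion N.
Proof.
move=> hM hN; have hMN := invertible_mx_lblock C hM hN.
rewrite !gl_torsionE.
pose i (x : free_mod R m) : free_mod R (m + n) := to_free (row_mx (\val x) 0).
pose j (x : free_mod R (m + n)) : free_mod R n := to_free (rsubmx (\val x)).
have i_lin : linear i.
  move=> a x y; apply: val_inj.
  by rewrite /= scale_row_mx add_row_mx scaler0 addr0.
have j_lin : linear j by move=> a x y; apply: val_inj; rewrite /= linearP.
pose Hi := GRing.isLinear.Build R _ _ _ i i_lin.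
pose i' : {linear free_mod R m -> free_mod R (m + n)} := HB.pack i Hi.
pose Hj := GRing.isLinear.Build R _ _ _ j j_lin.
pose j' : {linear free_mod R (m + n) -> free_mod R n} := HB.pack j Hj.
apply: (@torsion_exact_map R _ _ _ _ _ _ _ _ _ i' j').
- move=> x y /(congr1 \val) /= /(congr1 lsubmx); rewrite !row_mxKl.
  exact: val_inj.
- move=> x; split=> [/(congr1 \val) /= xr0|[y <-]].
    exists (to_free (lsubmx (\val x))); apply: val_inj.
    by rewrite /= -{2}[\val x]hsubmxK xr0.
  by apply: val_inj; rewrite /= row_mxKr.
- by move=> y; exists (to_free (row_mx 0 (\val y))); apply: val_inj;
    rewrite /= row_mxKr.
- by move=> x; apply: val_inj;
    rewrite /= mul_row_block !mul0mx mulmx0 !addr0.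
- move=> x; apply: val_inj => /=; rewrite -[\val x in LHS]hsubmxK mul_row_block.
  by rewrite row_mxKr mulmx0 add0r.
Qed.

Lemma gl_torsion_ublock m n (M : 'M[R]_m) B (N : 'M[R]_n) :
  invertible_mx M -> invertible_mx N ->
  gl_torsion (block_mx M B 0 N) = gl_torsion M + gl_torsion N.
Proof.
move=> hM hN; have hMN := invertible_mx_ublock B hM hN; rewrite addrC.
rewrite !gl_torsionE.
pose i (x : free_mod R n) : free_mod R (m + n) := to_free (row_mx 0 (\val x)).
pose j (x : free_mod R (m + n)) : free_mod R m := to_free (lsubmx (\val x)).
have i_lin : linear i.
  move=> a x y; apply: val_inj.
  by rewrite /= scale_row_mx add_row_mx scaler0 addr0.
have j_lin : linear j by move=> a x y; apply: val_inj; rewrite /= linearP.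
pose Hi := GRing.isLinear.Build R _ _ _ i i_lin.
pose i' : {linear free_mod R n -> free_mod R (m + n)} := HB.pack i Hi.
pose Hj := GRing.isLinear.Build R _ _ _ j j_lin.
pose j' : {linear free_mod R (m + n) -> free_mod R m} := HB.pack j Hj.
apply: (@torsion_exact_map R _ _ _ _ _ _ _ _ _ i' j').
- move=> x y /(congr1 \val) /= /(congr1 rsubmx); rewrite !row_mxKr.
  exact: val_inj.
- move=> x; split=> [/(congr1 \val) /= xl0|[y <-]].
    exists (to_free (rsubmx (\val x))); apply: val_inj.
    by rewrite /= -{2}[\val x]hsubmxK xl0.
  by apply: val_inj; rewrite /= row_mxKl.
- by move=> y; exists (to_free (row_mx (\val y) 0)); apply: val_inj;
    rewrite /= row_mxKl.
- by move=> x; apply: val_inj;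
    rewrite /= mul_row_block !mul0mx mulmx0 !add0r.
- move=> x; apply: val_inj => /=; rewrite -[\val x in LHS]hsubmxK mul_row_block.
  by rewrite row_mxKl mulmx0 addr0.
Qed.

(** Both sides are the torsion of [block_mx 1 U (- V) 1], which row and column
    elimination make triangular in two ways. *)
Lemma gl_torsion_1addC m n (U : 'M[R]_(m, n)) (V : 'M[R]_(n, m)) :
  invertible_mx (1%:M + U *m V) -> invertible_mx (1%:M + V *m U) ->
  gl_torsion (1%:M + U *m V) = gl_torsion (1%:M + V *m U).
Proof.
move=> hUV hVU; have h1 k := invertible_mx1 R k.
pose E := block_mx (1%:M : 'M[R]_m) 0 (- V) (1%:M : 'M[R]_n).
have hE : invertible_mx E by exact: invertible_mx_lblock.
have tE : gl_torsion E = 0 by rewrite gl_torsion_lblock // !gl_torsion1 addr0.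
pose X := block_mx (1%:M + U *m V) U 0 (1%:M : 'M[R]_n).
pose Y := block_mx (1%:M : 'M[R]_m) U 0 (1%:M + V *m U).
have XY : X *m E = E *m Y.
  rewrite !mulmx_block !(mul0mx, mulmx0, mul1mx, mulmx1, addr0, add0r).
  by rewrite mulmxN addrK mulNmx addrCA addNr addr0.
have hX : invertible_mx X by exact: invertible_mx_ublock.
have hY : invertible_mx Y by exact: invertible_mx_ublock.
have := congr1 (@gl_torsion _) XY; rewrite !gl_torsionM // tE addr0 add0r.
by rewrite !gl_torsion_ublock // !gl_torsion1 addr0 add0r.
Qed.

End GLTorsion.

(** * Homomorphisms defined on the Whitehead group *)

Lemma additive_K1_ext (R : pzRingType) (G : zmodType)
    (f g : {additive K1 R -> G}) :
  (forall a, f (torsion a) = g (torsion a)) -> f =1 g.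
Proof.
move=> fg x; rewrite -[x]reprK -[repr x]freeg_sumE !raddf_sum.
by apply: eq_bigr => a _; rewrite -[coeff _ _]intz -freegU_mulz !raddfMz fg.
Qed.

Lemma eq_mulmx_rV (R : pzRingType) m n (M N : 'M[R]_(m, n)) :
  (forall u : 'rV_m, u *m M = u *m N) -> M = N.
Proof. by move=> MN; apply/row_matrixP => i; rewrite !rowE. Qed.

Section StabilizedMatrix.
Variables (R : pzRingType) (P : lmodType R) (n : nat).
Variables (s : {linear P -> 'rV[R]_n}) (q : {linear 'rV[R]_n -> P}).
Hypothesis sK : cancel s q.

(** When [P] is a retract of [R^n], an endomorphism of [P] is extended by the
    identity on the complement of [P] and becomes a matrix. *)
Definition aut_mx (f : {linear P -> P}) : 'M[R]_n :=
  lin1_mx ((idfun \- (s \o q)) \+ (s \o (f \o q))).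

Lemma aut_mxE f u : u *m aut_mx f = u - s (q u) + s (f (q u)).
Proof. by rewrite mul_rV_lin1. Qed.

Lemma aut_mx_retract f u : q (u *m aut_mx f) = f (q u).
Proof. by rewrite aut_mxE linearD linearB /= !sK subrr add0r. Qed.

Lemma aut_mx_comp (f g : {linear P -> P}) :
  aut_mx (g \o f) = aut_mx f *m aut_mx g.
Proof.
apply: eq_mulmx_rV => u; rewrite mulmxA [RHS]aut_mxE aut_mx_retract !aut_mxE.
by rewrite addrK.
Qed.

Lemma aut_mx_id (f : {linear P -> P}) : f =1 id -> aut_mx f = 1%:M.
Proof.
by move=> fid; apply: eq_mulmx_rV => u; rewrite aut_mxE fid subrK mulmx1.
Qed.

Lemma aut_mx_invertible (f : {linear P -> P}) :
  bijective f -> invertible_mx (aut_mx f).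
Proof.
move=> /linear_inverse[g [fK gK]]; exists (aut_mx g).
by rewrite -!aut_mx_comp !aut_mx_id.
Qed.

End StabilizedMatrix.

(** The complement of [P] in [R^n] carries the identity, whose torsion is 0. *)
Lemma torsion_stabilized (R : pzRingType) (P : fgproj R) (f : {linear P -> P})
    (bf : bijective f) n (s : {linear P -> 'rV[R]_n})
    (q : {linear 'rV[R]_n -> P}) :
  cancel s q -> torsion (FGAut f bf) = gl_torsion (aut_mx s q f).
Proof.
move=> sK; have hM := aut_mx_invertible sK bf; rewrite (gl_torsionE hM).
pose U : {pred 'rV[R]_n} := fun u => q u == 0.
have U_closed : submod_closed U.
  split=> [|c x y]; first by rewrite unfold_in linear0.
  by rewrite !unfold_in => /eqP xU /eqP yU; rewrite linearP xU yU scaler0 addr0.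
pose HU := GRing.isSubmodClosed.Build R 'rV[R]_n U U_closed.
pose U' : submodClosed 'rV[R]_n := HB.pack U HU.
have pU x : x - s (q x) \in U' by rewrite unfold_in /= /U linearB sK subrr.
pose p (x : 'rV[R]_n) : submod_of U' := Sub (x - s (q x)) (pU x).
have p_linear : linear p.
  move=> c x y; apply: val_inj; rewrite /= (linearP q) (linearP s).
  by rewrite scalerBr opprD addrACA.
pose Hp := GRing.isLinear.Build R 'rV[R]_n (submod_of U') _ p p_linear.
pose p' : {linear 'rV[R]_n -> submod_of U'} := HB.pack p Hp.
have pK : cancel (\val : submod_of U' -> _) p'.
  by case=> u uU; apply: val_inj; move/eqP: (uU) => /= ->; rewrite linear0 subr0.
pose Q := FGProj (retract_fg pK) (retract_projective pK).
have bid : bijective (idfun : {linear Q -> Q}) by exists id.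
suff -> : torsion_mx hM = torsion (FGAut f bf) + torsion (FGAut _ bid).
  by rewrite [torsion (FGAut _ bid)]torsion_id ?addr0.
pose i : {linear P -> free_mod R n} := to_free (n := n) \o s.
pose j : {linear free_mod R n -> Q} := p' \o \val.
apply: (@torsion_exact_map R _ _ _ _ _ _ _ _ _ i j).
- by move=> x y /(congr1 \val) /= /(can_inj sK).
- move=> x; split=> [/(congr1 \val) /= /eqP|[y <-]].
    by rewrite subr_eq0 => /eqP xE; exists (q (\val x)); apply: val_inj.
  by apply: val_inj; rewrite /= sK subrr.
- by move=> z; exists (to_free (\val z)); apply: pK.
- by move=> x; apply: val_inj; rewrite /= aut_mxE sK subrr add0r.
- move=> x; apply: val_inj; rewrite /= aut_mxE linearD linearB /= !sK subrr add0r.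
  by rewrite addrK.
Qed.

Lemma torsion_is_mx (R : pzRingType) (a : fgaut R) :
  exists n (M : 'M[R]_n), invertible_mx M /\ torsion a = gl_torsion M.
Proof.
case: a => P f bf; have [n [s [q sK]]] := fgproj_retract (fgp_fg P) (fgp_proj P).
exists n, (aut_mx s q f); split; last exact: torsion_stabilized.
exact: aut_mx_invertible bf.
Qed.

Section K1MapMatrix.
Variables (R S : pzRingType) (phi : {rmorphism R -> S}) (n : nat).

Definition free_base_change (x : free_mod R n) : free_mod S n :=
  to_free (map_mx phi (\val x)).

Fact free_base_change_linear : linear_for (phi \; *:%R) free_base_change.
Proof.
move=> a x y; apply: val_inj; rewrite /= map_mxD; congr (_ + _).
by apply/rowP => i; rewrite !mxE /= rmorphM.
Qed.
HB.instance Definition _ := GRing.isLinear.Build R (free_mod R n) (free_mod S n)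
  (phi \; *:%R) free_base_change free_base_change_linear.

Lemma free_base_changeP : is_base_change free_base_change.
Proof.
move=> N h; pose b i := to_free (delta_mx 0 i : 'rV[R]_n).
have xE (x : free_mod R n) : x = \sum_i (\val x) 0 i *: (b i : free_mod R n).
  apply: val_inj; rewrite raddf_sum {1}[\val x]row_sum_delta.
  by apply: eq_bigr => i _.
pose k : {linear free_mod S n -> N} := lin_comb (fun i => h (b i)) \o \val.
exists k => [x|k' k'P y]; rewrite /k /=.
  rewrite [in RHS](xE x) linear_sum; apply: eq_bigr => i _.
  by rewrite linearZ_LR /= mxE.
rewrite -[y]to_freeK /=.
have /= -> := lin_combE (k' \o to_free (n := n)) (\val y).
apply: eq_bigr => i _; congr (_ *: _); rewrite -k'P; congr (k' _).
by apply: val_inj; rewrite /= map_delta_mx.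
Qed.

Lemma K1_map_gl_torsion (M : 'M[R]_n) :
  invertible_mx M -> K1_map phi (gl_torsion M) = gl_torsion (map_mx phi M).
Proof.
move=> hM; rewrite (gl_torsionE hM) (gl_torsionE (invertible_mx_map phi hM)).
pose u : {linear free_mod R n -> free_mod S n | phi \; *:%R} := free_base_change.
apply: (@K1_mapE R S phi (FGAut _ (mulmx_map_bij hM))
  (FGAut _ (mulmx_map_bij (invertible_mx_map phi hM))) u) => [|x].
  exact: free_base_changeP.
by apply: val_inj; rewrite /= map_mxM.
Qed.

End K1MapMatrix.


Section GLFunctional.
Variables (R : pzRingType) (G : zmodType) (D : forall n, 'M[R]_n -> G).
Hypothesis DM : forall n (M N : 'M[R]_n),
  invertible_mx M -> invertible_mx N -> D (M *m N) = D M + D N.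
Hypothesis D_stabr : forall m n (M : 'M[R]_m), invertible_mx M ->
  D (block_mx M 0 0 (1%:M : 'M[R]_n)) = D M.
Hypothesis D_stabl : forall m n (M : 'M[R]_n), invertible_mx M ->
  D (block_mx (1%:M : 'M[R]_m) 0 0 M) = D M.

(** When [V *m U = 0], stabilization makes [1 + U *m V] a commutator. *)
Let D_1add0 m n (U : 'M[R]_(m, n)) (V : 'M[R]_(n, m)) :
  V *m U = 0 -> D (1%:M + U *m V) = 0.
Proof.
move=> VU; have h1 k := invertible_mx1 R k.
have hUV : invertible_mx (1%:M + U *m V).
  have UVUV : U *m V *m (U *m V) = 0.
    by rewrite mulmxA -(mulmxA U) VU mulmx0 mul0mx.
  exists (1%:M - U *m V); split.
    by rewrite mulmxBr mulmx1 mulmxDl mul1mx UVUV addr0 addrK.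
  by rewrite mulmxDr mulmx1 mulmxBl mul1mx UVUV subr0 subrK.
pose X := block_mx (1%:M : 'M[R]_m) U 0 (1%:M : 'M[R]_n).
pose Y := block_mx (1%:M : 'M[R]_m) 0 V (1%:M : 'M[R]_n).
have hX : invertible_mx X by exact: invertible_mx_ublock.
have hY : invertible_mx Y by exact: invertible_mx_lblock.
have XY : X *m Y = block_mx (1%:M + U *m V) 0 0 1%:M *m (Y *m X).
  rewrite !mulmx_block !(mul0mx, mulmx0, mul1mx, mulmx1, addr0, add0r) VU add0r.
  by rewrite mulmxDl mul1mx -mulmxA VU mulmx0 addr0.
have hB : invertible_mx (block_mx (1%:M + U *m V) 0 0 (1%:M : 'M[R]_n)).
  exact: invertible_mx_ublock.
have := congr1 (@D _) XY.
rewrite [in RHS]DM ?D_stabr //; last exact: invertible_mxM.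
rewrite !DM // (addrC (D Y)) -[LHS]add0r => /addIr <-.
by [].
Qed.

Let D_lblock m n (M : 'M[R]_m) C (N : 'M[R]_n) :
  invertible_mx M -> invertible_mx N -> D (block_mx M 0 C N) = D M + D N.
Proof.
move=> hM hN; have h1 k := invertible_mx1 R k.
have -> : block_mx M 0 C N = block_mx M 0 0 1%:M *m
    (block_mx 1%:M 0 C 1%:M *m block_mx 1%:M 0 0 N).
  by rewrite !mulmx_block !(mul0mx, mulmx0, mul1mx, mulmx1, addr0, add0r).
have hC : invertible_mx (block_mx (1%:M : 'M[R]_m) 0 C (1%:M : 'M[R]_n)).
  exact: invertible_mx_lblock.
have hM1 : invertible_mx (block_mx M 0 0 (1%:M : 'M[R]_n)).
  exact: invertible_mx_lblock.
have hN1 : invertible_mx (block_mx (1%:M : 'M[R]_m) 0 0 N).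
  exact: invertible_mx_lblock.
rewrite !DM ?D_stabr ?D_stabl //; last exact: invertible_mxM.
suff -> : D (block_mx 1%:M 0 C 1%:M) = 0 by rewrite add0r.
pose U : 'M[R]_(m + n, m) := col_mx 0 C.
pose V : 'M[R]_(m, m + n) := row_mx 1%:M 0.
have <- : 1%:M + U *m V = block_mx 1%:M 0 C 1%:M.
  rewrite scalar_mx_block mul_col_row !(mul0mx, mulmx1, mulmx0) add_block_mx.
  by rewrite !addr0 add0r.
by apply: D_1add0; rewrite mul_row_col mulmx0 mul0mx addr0.
Qed.

(** Two presentations of [P] as a retract are interchanged by an involution of
    [R^(m + n)], so the extended matrices are conjugate after stabilization. *)
Let D_aut_mx_indep (P : lmodType R) m n
    (s : {linear P -> 'rV[R]_m}) (q : {linear 'rV[R]_m -> P})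
    (s' : {linear P -> 'rV[R]_n}) (q' : {linear 'rV[R]_n -> P})
    (f : {linear P -> P}) :
  cancel s q -> cancel s' q' -> bijective f ->
  D (aut_mx s q f) = D (aut_mx s' q' f).
Proof.
move=> sK sK' bf; have h1 k := invertible_mx1 R k.
have hM := aut_mx_invertible sK bf; have hM' := aut_mx_invertible sK' bf.
pose W := block_mx (lin1_mx (idfun \- (s \o q))) (lin1_mx (s' \o q))
                   (lin1_mx (s \o q')) (lin1_mx (idfun \- (s' \o q'))).
have WE x y : row_mx x y *m W =
    row_mx (x - s (q x) + s (q' y)) (s' (q x) + (y - s' (q' y))).
  by rewrite mul_row_block !mul_rV_lin1.
clearbody W.
have qW x y : q (x - s (q x) + s (q' y)) = q' y.
  by rewrite linearD linearB /= !sK subrr add0r.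
have q'W x y : q' (s' (q x) + (y - s' (q' y))) = q x.
  by rewrite linearD linearB /= !sK' subrr addr0.
have WW : W *m W = 1%:M.
  apply: eq_mulmx_rV => u; rewrite mulmxA mulmx1 -[u]hsubmxK !WE qW q'W.
  set y := rsubmx u; rewrite addrK subrK; congr row_mx.
  by rewrite (addrC (s' _) (y - _)) addrK addrC subrK.
have hW : invertible_mx W by exists W.
have conjW : block_mx (aut_mx s q f) 0 0 1%:M *m W =
             W *m block_mx 1%:M 0 0 (aut_mx s' q' f).
  apply: eq_mulmx_rV => u; rewrite !mulmxA -[u]hsubmxK WE !mul_row_block.
  rewrite !(mulmx0, mulmx1, addr0, add0r) WE (aut_mx_retract sK) (aut_mxE s').
  rewrite q'W aut_mxE addrK; congr row_mx.
  by rewrite (addrC (s' (q _)) (_ - _)) addrK addrC.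
have := congr1 (@D _) conjW; rewrite !DM ?D_stabr ?D_stabl 1?addrC //.
- by move/addrI.
- exact: invertible_mx_lblock.
- exact: invertible_mx_lblock.
Qed.

Let D_of (a : fgaut R) : G :=
  let w := cid (fgproj_retract (fgp_fg (aut_mod a)) (fgp_proj (aut_mod a))) in
  let w' := cid (projT2 w) in let w'' := cid (projT2 w') in
  D (aut_mx (projT1 w') (projT1 w'') (aut_map a)).

Let D_ofE (P : fgproj R) (f : {linear P -> P}) (bf : bijective f) n
    (s : {linear P -> 'rV[R]_n}) (q : {linear 'rV[R]_n -> P}) :
  cancel s q -> D_of (FGAut f bf) = D (aut_mx s q f).
Proof.
move=> sK; apply: D_aut_mx_indep => //.
pose w := cid (fgproj_retract (fgp_fg P) (fgp_proj P)).
exact: (projT2 (cid (projT2 (cid (projT2 w))))).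
Qed.

Let D_of_comp (P : fgproj R) (f g : {linear P -> P})
    (bf : bijective f) (bg : bijective g) (bgf : bijective (g \o f)) :
  D_of (FGAut (g \o f) bgf) = D_of (FGAut f bf) + D_of (FGAut g bg).
Proof.
have [n [s [q sK]]] := fgproj_retract (fgp_fg P) (fgp_proj P).
rewrite !(D_ofE _ sK) (aut_mx_comp sK) DM //; exact: aut_mx_invertible.
Qed.

Let D_of_exact (a b c : fgaut R) (i : {linear aut_mod a -> aut_mod b})
    (j : {linear aut_mod b -> aut_mod c}) :
  injective i -> (forall x, j x = 0 <-> exists y, i y = x) ->
  (forall z, exists x, j x = z) ->
  (forall x, i (aut_map a x) = aut_map b (i x)) ->
  (forall x, j (aut_map b x) = aut_map c (j x)) ->
  D_of b = D_of a + D_of c.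
Proof.
case: a b c i j => P f bf [Q g bg] [T h bh] /= i j inj_i ex_ij surj_j ifg jgh.
have [t [r [iK rK itE]]] := split_exact (@fgp_proj _ T) inj_i ex_ij surj_j.
have ji x : j (i x) = 0 by apply/ex_ij; exists x.
have tr x : t (r x) = 0 by apply: inj_i; rewrite itE rK subrr linear0.
have [m [s [q sK]]] := fgproj_retract (fgp_fg P) (fgp_proj P).
have [n [s' [q' sK']]] := fgproj_retract (fgp_fg T) (fgp_proj T).
pose s2 x : 'rV[R]_(m + n) := row_mx (s (t x)) (s' (j x)).
pose q2 (u : 'rV[R]_(m + n)) : Q := i (q (lsubmx u)) + r (q' (rsubmx u)).
have s2_lin : linear s2.
  by move=> c x y; rewrite /s2 !linearP /= scale_row_mx add_row_mx.
have q2_lin : linear q2.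
  move=> c x y; by rewrite /q2 !linearP scalerDr addrACA.
pose Hs := GRing.isLinear.Build R _ _ _ s2 s2_lin.
pose S2 : {linear Q -> 'rV[R]_(m + n)} := HB.pack s2 Hs.
pose Hq := GRing.isLinear.Build R _ _ _ q2 q2_lin.
pose Q2 : {linear 'rV[R]_(m + n) -> Q} := HB.pack q2 Hq.
have sK2 : cancel S2 Q2.
  by move=> x; rewrite /= /q2 row_mxKl row_mxKr sK sK' itE subrK.
rewrite (D_ofE _ sK2) (D_ofE _ sK) (D_ofE _ sK').
pose C := lin1_mx (s \o (t \o (g \o (r \o q')))).
have -> : aut_mx S2 Q2 g = block_mx (aut_mx s q f) 0 C (aut_mx s' q' h).
  apply: eq_mulmx_rV => u; rewrite -[u]hsubmxK mul_row_block !mulmx0 add0r.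
  set x := lsubmx u; set y := rsubmx u.
  rewrite !aut_mxE /C mul_rV_lin1 /= /s2 /q2 row_mxKl row_mxKr.
  rewrite !linearD /= -ifg !jgh !iK !ji !rK !tr !linear0 addr0 !add0r.
  by rewrite opp_row_mx !add_row_mx addrA.
apply: D_lblock; exact: aut_mx_invertible.
Qed.

(** An automorphism [f] of [P] is sent to the value of [D] on the stabilized
    matrix of [f]; a short exact sequence splits, and gives a block triangular
    matrix. *)
Theorem K1_functional : exists L : {additive K1 R -> G},
  forall n (M : 'M[R]_n), invertible_mx M -> L (gl_torsion M) = D M.
Proof.
have [L LE] := k1_lift_exists D_of_comp D_of_exact.
exists L => n M hM; rewrite (gl_torsionE hM) LE.
pose v : {linear free_mod R n -> 'rV[R]_n} := \val.
pose w : {linear 'rV[R]_n -> free_mod R n} := @to_free R n.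
have vK : cancel v w by exact: to_freeK.
rewrite (D_ofE _ vK); congr D; apply: eq_mulmx_rV => u.
by rewrite aut_mxE subrr add0r.
Qed.

End GLFunctional.

(** * Matrices of power series with identity constant term *)

Section WittMatrices.
Variables (A : pzRingType) (rho : ring_aut A).
Local Notation S := (pseries rho).

Lemma pseries_mulE (f g : S) k :
  (f * g) k = \sum_(i < k.+1) f i * ztwist rho i (g (k - i)%N).
Proof. by []. Qed.

Lemma pseries_coefB (f g : S) k : (f - g) k = f k - g k.
Proof. by []. Qed.

Definition pseries_aug (f : S) : A := f 0.

Fact pseries_aug_zmod : zmod_morphism pseries_aug. Proof. by []. Qed.
HB.instance Definition _ :=
  GRing.isZmodMorphism.Build S A pseries_aug pseries_aug_zmod.

Fact pseries_aug_monoid : monoid_morphism pseries_aug.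
Proof. by split=> // f g; rewrite /pseries_aug pseries_mulE big_ord1. Qed.
HB.instance Definition _ :=
  GRing.isMonoidMorphism.Build S A pseries_aug pseries_aug_monoid.

Lemma pseries_mul_eqr (f g h : S) n :
  (forall j, (j <= n)%N -> g j = h j) -> (f * g) n = (f * h) n.
Proof.
by move=> gh; rewrite !pseries_mulE; apply: eq_bigr => i _; rewrite gh ?leq_subr.
Qed.

Lemma pseries_expr_coef (x : S) k n : x 0%N = 0 -> (n < k)%N -> (x ^+ k) n = 0.
Proof.
move=> x0; elim: k n => [//|k IHk] n nk; rewrite exprS pseries_mulE big1 // => i _.
case: (posnP i) => [->|i0]; first by rewrite x0 mul0r.
by rewrite IHk ?rmorph0 ?mulr0 //; have := ltn_ord i; lia.
Qed.

Lemma pseries_coef_sum (I : Type) (r : seq I) (P : pred I) (F : I -> S) k :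
  (\sum_(i <- r | P i) F i) k = \sum_(i <- r | P i) F i k.
Proof. by apply: (big_morph (fun f : S => f k)). Qed.

(** The inverse is the geometric series in x = 1 - w, whose coefficient of t^n
    is that of the finite sum [p n]. *)
Let pseries_right_inverse (w : S) : w 0%N = 1 -> exists2 v : S, w * v = 1 & v 0%N = 1.
Proof.
move=> w0; pose x : S := 1 - w; have x0 : x 0%N = 0 by rewrite /= w0 subrr.
pose p n : S := \sum_(k < n.+1) x ^+ k.
have pE n j : (j <= n)%N -> p n j = p j j.
  move=> jn; rewrite /p -!(big_mkord xpredT (fun k => x ^+ k)).
  rewrite (big_cat_nat _ (n := j.+1)) //=.
  rewrite [X in _ + X = _]pseries_coef_sum [X in _ + X = _]big_nat_cond.
  rewrite [X in _ + X = _]big1 ?addr0 // => k /andP[/andP[jk _] _].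
  exact: pseries_expr_coef.
exists (PSeries (fun n => p n n)); last by rewrite /= /p big_ord1.
apply: pseries_ext => n.
rewrite (@pseries_mul_eqr _ _ (p n)); last by move=> j jn; rewrite /= pE.
have -> : w * p n = 1 - x ^+ n.+1.
  by rewrite -[w]opprK -[- w](addKr 1) -/x addrC mulNr -subrX1 opprB.
by rewrite [LHS]/= pseries_expr_coef // subr0.
Qed.

Lemma pseries_invertible (w : S) : w 0%N = 1 -> invertible w.
Proof.
move=> /pseries_right_inverse[v wv v0]; exists v; split=> //.
have [u vu _] := pseries_right_inverse v0.
suff <- : u = w by [].
by rewrite -[LHS]mul1r -wv -mulrA vu mulr1.
Qed.

Definition witt_mx n (M : 'M[S]_n) := map_mx pseries_aug M = 1%:M.

(** Gaussian elimination: a matrix that reduces to the identity can be made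
    upper triangular without pivoting, and its pivots are Witt vectors. *)
Lemma witt_mx_torsion n (M : 'M[S]_n) : witt_mx M ->
  invertible_mx M /\ gl_torsion M \in @witt_torsions A rho.
Proof.
elim: n M => [|n IHn] M wM.
  have -> : M = 1%:M by rewrite [LHS]thinmx0 [RHS]thinmx0.
  by split; [exact: invertible_mx1 | rewrite gl_torsion1 rpred0].
suff {M wM} elim_step (M : 'M[S]_(1 + n)) : map_mx pseries_aug M = 1%:M ->
    invertible_mx M /\ gl_torsion M \in @witt_torsions A rho.
  exact: elim_step.
rewrite -[M]submxK.
set b := ursubmx M; set c := dlsubmx M; set e := drsubmx M.
rewrite (mx11_scalar (ulsubmx M)); set a := ulsubmx M 0 0.
rewrite map_block_mx map_scalar_mx scalar_mx_block => /eq_block_mx[a1 b0 c0 e1].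
have {}a1 : a 0%N = 1 by have /matrixP/(_ 0 0) := a1; rewrite !mxE.
have ha := pseries_invertible a1; have [a' [aa' a'a]] := ha.
pose X : 'M[S]_(1 + n) := block_mx 1%:M 0 (c *m a'%:M) 1%:M.
pose Y : 'M[S]_(1 + n) := block_mx a%:M b 0 (e - c *m a'%:M *m b).
have -> : block_mx a%:M b c e = X *m Y.
  rewrite mulmx_block !(mul0mx, mulmx0, mul1mx, mulmx1, addr0, add0r).
  by rewrite -mulmxA -scalar_mxM a'a mulmx1 addrC subrK.
have [|he we] := IHn (e - c *m a'%:M *m b).
  by rewrite /witt_mx map_mxB !map_mxM c0 e1 !mul0mx subr0.
have hX : invertible_mx X by apply: invertible_mx_lblock; exact: invertible_mx1.
have hY : invertible_mx Y.
  by apply: invertible_mx_ublock he; exact: invertible_mx11.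
split; first exact: invertible_mxM.
rewrite gl_torsionM // gl_torsion_lblock; [|exact: invertible_mx1..].
rewrite !gl_torsion1 !add0r gl_torsion_ublock //; last exact: invertible_mx11.
rewrite rpredD // (gl_torsionE (invertible_mx11 ha)); apply/asboolP.
by exists a, ha.
Qed.

End WittMatrices.

(** * Twisted Laurent series over the ring of twisted power series *)

Local Arguments ztwist : simpl never.

Section LaurentCoefficients.
Variables (A : pzRingType) (rho : ring_aut A).
Local Notation L := (laurent rho).

Lemma lcoef_sum (I : Type) (r : seq I) (P : pred I) (F : I -> L) q :
  (\sum_(i <- r | P i) F i) q = \sum_(i <- r | P i) F i q.
Proof. by apply: (big_morph (fun f : L => f q)). Qed.

Lemma lmono_mul_coef (a : A) (k : int) (f : L) q :
  (lmono rho a k * f) q = a * ztwist rho k (f (q - k)).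
Proof.
rewrite [LHS]/= /lmul_coef (@fsum_seq _ [:: k]) //= ?big_seq1 ?eqxx //.
by move=> l; rewrite inE => /negPf ->; rewrite mul0r.
Qed.

Lemma lmono_add (a b : A) k : lmono rho (a + b) k = lmono rho a k + lmono rho b k.
Proof. by apply: laurent_ext => q /=; case: ifP; rewrite ?addr0. Qed.

Definition ord_ge (k : int) m n (M : 'M[L]_(m, n)) :=
  forall i j q, q < k -> M i j q = 0.

Lemma ord_ge_le k l m n (M : 'M[L]_(m, n)) : l <= k -> ord_ge k M -> ord_ge l M.
Proof. by move=> lk kM i j q ql; apply: kM; lia. Qed.

Lemma ord_geD k m n (M N : 'M[L]_(m, n)) :
  ord_ge k M -> ord_ge k N -> ord_ge k (M + N).
Proof. by move=> kM kN i j q qk; rewrite mxE /= kM ?kN ?addr0. Qed.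

Lemma ord_geN k m n (M : 'M[L]_(m, n)) : ord_ge k M -> ord_ge k (- M).
Proof. by move=> kM i j q qk; rewrite mxE /= kM ?oppr0. Qed.

Lemma ord_geM k l m n p (M : 'M[L]_(m, n)) (N : 'M[L]_(n, p)) :
  ord_ge k M -> ord_ge l N -> ord_ge (k + l) (M *m N).
Proof.
move=> kM lN i j q qkl; rewrite mxE lcoef_sum big1 // => h _ /=.
have [B fB] := lcoef_bounded (M i h); have [C gC] := lcoef_bounded (N h j).
rewrite (lmul_coefE fB gC (leqnn _)) big1 // => e _.
have [ek|ek] := ltP e k; first by rewrite kM ?mul0r.
by rewrite lN ?rmorph0 ?mulr0 //; lia.
Qed.

Lemma ord_ge_exists m n (M : 'M[L]_(m, n)) :
  exists r : nat, ord_ge (- r%:Z) M.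
Proof.
have /choice[r rP] i : exists r : nat, forall j q, q < - r%:Z -> M i j q = 0.
  have /choice[r rP] j := lcoef_bounded (M i j).
  exists (\sum_j r j)%N => j q qr; apply: rP.
  by move: qr; rewrite (bigD1 j) //=; lia.
exists (\sum_i r i)%N => i j q qr; apply: rP.
by move: qr; rewrite (bigD1 i) //=; lia.
Qed.

End LaurentCoefficients.

Section LaurentMap.
Variables (A B : pzRingType) (rhoA : ring_aut A) (rhoB : ring_aut B).
Variable phi : {rmorphism A -> B}.
Hypothesis phi_rho : forall a, phi (rhoA a) = rhoB (phi a).

Lemma ztwist_morph i a : phi (ztwist rhoA i a) = ztwist rhoB i (phi a).
Proof.
have phi_inv b : phi (raut_inv rhoA b) = raut_inv rhoB (phi b).
  by rewrite -{2}(raut_invK rhoA b) phi_rho rautK.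
case: i => n; rewrite /ztwist /=; first by elim: n => //= n IHn; rewrite phi_inv IHn.
by rewrite phi_rho; congr (rhoB _); elim: n => //= n IHn; rewrite phi_rho IHn.
Qed.

Fact laurent_map_bounded (f : laurent rhoA) :
  exists N : nat, forall j : int, j < - N%:Z -> phi (f j) = 0.
Proof.
by have [N fN] := lcoef_bounded f; exists N => j /fN ->; rewrite rmorph0.
Qed.
Definition laurent_map (f : laurent rhoA) : laurent rhoB :=
  Laurent _ (laurent_map_bounded f).

Lemma laurent_map_zmod : zmod_morphism laurent_map.
Proof. by move=> f g; apply: laurent_ext => j /=; rewrite rmorphB. Qed.

Lemma laurent_map_monoid : monoid_morphism laurent_map.
Proof.
split=> [|f g]; apply: laurent_ext => j /=.
  by case: ifP; rewrite ?rmorph1 ?rmorph0.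
have [M fM] := lcoef_bounded f; have [N gN] := lcoef_bounded g.
rewrite (lmul_coefE fM gN (leqnn _)).
have fM' i : i < - M%:Z -> laurent_map f i = 0 by move=> /fM /= ->; rewrite rmorph0.
have gN' i : i < - N%:Z -> laurent_map g i = 0 by move=> /gN /= ->; rewrite rmorph0.
rewrite (lmul_coefE fM' gN' (leqnn _)).
by rewrite rmorph_sum; apply: eq_bigr => i _ /=; rewrite rmorphM /= ztwist_morph.
Qed.

End LaurentMap.

Section PowerSeriesAutomorphism.
Variables (A : pzRingType) (rho : ring_aut A).
Local Notation S := (pseries rho).

Lemma ztwist_raut i a : rho (ztwist rho i a) = ztwist rho i (rho a).
Proof. by rewrite -ztwistP ztwistD. Qed.

Definition pseries_raut (f : S) : S := PSeries (fun n => rho (f n)).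
Definition pseries_raut_inv (f : S) : S := PSeries (fun n => raut_inv rho (f n)).

Fact pseries_raut_zmod : zmod_morphism pseries_raut.
Proof. by move=> f g; apply: pseries_ext => n /=; rewrite rmorphB. Qed.
HB.instance Definition _ :=
  GRing.isZmodMorphism.Build S S pseries_raut pseries_raut_zmod.

Fact pseries_raut_monoid : monoid_morphism pseries_raut.
Proof.
split=> [|f g]; apply: pseries_ext => n /=.
  by case: ifP; rewrite ?rmorph1 ?rmorph0.
rewrite rmorph_sum; apply: eq_bigr => i _ /=.
by rewrite rmorphM /= ztwist_raut.
Qed.
HB.instance Definition _ :=
  GRing.isMonoidMorphism.Build S S pseries_raut pseries_raut_monoid.

Fact pseries_rautK : cancel pseries_raut pseries_raut_inv.
Proof. by move=> f; apply: pseries_ext => n /=; rewrite rautK. Qed.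
Fact pseries_raut_invK : cancel pseries_raut_inv pseries_raut.
Proof. by move=> f; apply: pseries_ext => n /=; rewrite raut_invK. Qed.

(** The extension of [rho] that fixes the variable: with it, the variable [z] of
    [laurent pseries_aut] commutes with the variable of [S]. *)
Definition pseries_aut : ring_aut S := RingAut pseries_rautK pseries_raut_invK.

(** The variable of [S], written t to keep it apart from the z of
    [laurent pseries_aut]. *)
Definition pseries_t : S := PSeries (fun n => if n == 1%N then 1 else 0).

Lemma mul_pseries_t (f : S) n : (f * pseries_t) n = if n is k.+1 then f k else 0.
Proof.
rewrite pseries_mulE; case: n => [|n].
  by rewrite big_ord1 /= mulr0.
rewrite big_ord_recr /= subnn rmorph0 mulr0 addr0.
rewrite big_ord_recr /= subSnn /= rmorph1 mulr1 big1 ?add0r // => i _.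
have -> : (n.+1 - i == 1)%N = false by have := ltn_ord i; lia.
by rewrite rmorph0 mulr0.
Qed.

Lemma pseries_t_mul (f : S) : pseries_t * pseries_aut f = f * pseries_t.
Proof.
apply: pseries_ext => n; rewrite mul_pseries_t pseries_mulE; case: n => [|n].
  by rewrite big_ord1 /= mul0r.
rewrite big_ord_recl /= mul0r add0r big_ord_recl /= mul1r subSS subn0.
by rewrite big1 ?addr0 => [|i _]; [exact: rautK | rewrite mul0r].
Qed.

Definition pseries_const (a : A) : S := PSeries (fun n => if n == 0%N then a else 0).

Fact pseries_const_zmod : zmod_morphism pseries_const.
Proof. by move=> a b; apply: pseries_ext => n /=; case: ifP; rewrite ?subr0. Qed.
HB.instance Definition _ :=
  GRing.isZmodMorphism.Build A S pseries_const pseries_const_zmod.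

Fact pseries_const_monoid : monoid_morphism pseries_const.
Proof.
split=> // a b; apply: pseries_ext => n /=; rewrite big_ord_recl /= subn0.
rewrite big1 ?addr0 => [|i _]; last by rewrite mul0r.
by case: ifP; rewrite ?mulr0.
Qed.
HB.instance Definition _ :=
  GRing.isMonoidMorphism.Build A S pseries_const pseries_const_monoid.

Local Notation LS := (laurent pseries_aut).

Definition laurent_ext_scalars : laurent rho -> LS :=
  laurent_map pseries_aut pseries_const.

Fact pseries_const_raut a : pseries_const (rho a) = pseries_aut (pseries_const a).
Proof. by apply: pseries_ext => n /=; case: ifP; rewrite ?rmorph0. Qed.

HB.instance Definition _ := GRing.isZmodMorphism.Build (laurent rho) LS
  laurent_ext_scalars (@laurent_map_zmod _ _ _ _ _).
HB.instance Definition _ := GRing.isMonoidMorphism.Build (laurent rho) LS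
  laurent_ext_scalars (laurent_map_monoid pseries_const_raut).

Definition laurent_aug : LS -> laurent rho := laurent_map rho (@pseries_aug A rho).

Fact pseries_aug_raut f : pseries_aug (pseries_aut f) = rho (pseries_aug f).
Proof. by []. Qed.

HB.instance Definition _ := GRing.isZmodMorphism.Build LS (laurent rho)
  laurent_aug (@laurent_map_zmod _ _ _ _ _).
HB.instance Definition _ := GRing.isMonoidMorphism.Build LS (laurent rho)
  laurent_aug (laurent_map_monoid pseries_aug_raut).

Lemma ord_ge_ext_scalars k m n (M : 'M[laurent rho]_(m, n)) :
  ord_ge k M -> ord_ge k (map_mx laurent_ext_scalars M).
Proof. by move=> kM i j q qk; rewrite mxE /= kM ?rmorph0. Qed.

End PowerSeriesAutomorphism.

(** * The truncated shift *)

Section Shift.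
Variables (A : pzRingType) (rho : ring_aut A).
Local Notation S := (pseries rho).
Local Notation LS := (laurent (pseries_aut rho)).
Local Notation t := (pseries_t rho).

(** This is t z^-1 f with the negative powers of z removed: the coefficient
    t rho (f_(q+1)) of t z^-1 f at z^q is f_(q+1) t by [pseries_t_mul]. *)
Fact shift_bounded (f : LS) : exists N : nat, forall q : int, q < - N%:Z ->
  (if 0 <= q then f (q + 1) * t else 0) = 0.
Proof. by exists 0 => q q0; case: ifP => // ?; lia. Qed.
Definition shift (f : LS) : LS := Laurent _ (shift_bounded f).

Definition resolvent (f : LS) : LS := f - shift f.

(** The geometric series f + T f + T^2 f + ... in the shift T; it is finite in
    each power of t. *)
Fact resolvent_inv_bounded (f : LS) : exists N : nat, forall q : int, q < - N%:Z ->
  (if 0 <= q then PSeries (fun k => \sum_(m < k.+1) f (q + m%:Z) (k - m)%N)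
   else f q) = 0.
Proof.
have [N fN] := lcoef_bounded f; exists N => q qN.
by case: ifP => [|_]; [lia | exact: fN].
Qed.
Definition resolvent_inv (f : LS) : LS := Laurent _ (resolvent_inv_bounded f).

Lemma resolvent_zmod : zmod_morphism resolvent.
Proof.
move=> f g; rewrite /resolvent; have -> : shift (f - g) = shift f - shift g.
  by apply: laurent_ext => q /=; case: ifP; rewrite ?subr0 // mulrBl.
by rewrite !opprD !opprK addrACA.
Qed.
HB.instance Definition _ := GRing.isZmodMorphism.Build LS LS resolvent resolvent_zmod.

Lemma resolvent_coef f q : resolvent f q =
  if 0 <= q then f q - f (q + 1) * t else f q.
Proof. by rewrite /=; case: ifP; rewrite ?subr0. Qed.

Lemma resolvent_scale (s : S) f :
  resolvent (lmono _ s 0 * f) = lmono _ s 0 * resolvent f.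
Proof.
apply: laurent_ext => q; rewrite lmono_mul_coef !resolvent_coef !lmono_mul_coef.
by rewrite /ztwist /= !subr0; case: ifP => // _; rewrite mulrBr mulrA.
Qed.

(** If f = T f, then every coefficient of f is divisible by all powers of t. *)
Lemma resolvent_inj : injective resolvent.
Proof.
move=> f g /(congr1 (fun h => h - resolvent g)); rewrite subrr -raddfB => fg0.
apply/eqP; rewrite -subr_eq0; apply/eqP; move: (f - g) fg0 => {f g} f f0.
have fq q : f q = if 0 <= q then f (q + 1) * t else 0.
  have := congr1 (fun h : LS => h q) f0; rewrite resolvent_coef.
  by case: ifP => // _ /eqP; rewrite subr_eq0 => /eqP.
apply: laurent_ext => q; apply: pseries_ext => k /=.
elim: k q => [|k IHk] q; rewrite fq; case: ifP => // _;
  by rewrite mul_pseries_t ?IHk.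
Qed.

Lemma resolvent_invK : cancel resolvent_inv resolvent.
Proof.
move=> f; apply: laurent_ext => q; rewrite resolvent_coef.
case: ifP => q0 /=; rewrite q0 //; have -> : 0 <= q + 1 by lia.
apply: pseries_ext => k; rewrite pseries_coefB mul_pseries_t /= big_ord_recl.
rewrite subn0 addr0; case: k => [|k]; first by rewrite big_ord0 addr0 subr0.
rewrite -[RHS]addr0 -addrA; congr (_ + _); apply/eqP; rewrite subr_eq0; apply/eqP.
apply: eq_bigr => m _; rewrite /= /bump /= add1n subSS.
by congr (f _ _); lia.
Qed.

Lemma resolventK : cancel resolvent resolvent_inv.
Proof. by move=> f; apply: resolvent_inj; rewrite resolvent_invK. Qed.

Lemma laurent_aug_resolvent f : laurent_aug (resolvent f) = laurent_aug f.
Proof.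
apply: laurent_ext => q; rewrite /= /pseries_aug; case: ifP => _ /=.
  by rewrite -[LHS]/((f q - f (q + 1) * t) 0%N) pseries_coefB mul_pseries_t subr0.
by rewrite subr0.
Qed.

(** On series of positive order the shift is left multiplication by t z^-1, and
    so commutes with right multiplication by matrices. *)
Lemma resolvent_deep (f : LS) : (forall q, q < 1 -> f q = 0) ->
  resolvent f = (1 - lmono _ t (-1)) * f.
Proof.
move=> f1; rewrite mulrBl mul1r; congr (_ - _); apply: laurent_ext => q.
rewrite lmono_mul_coef [LHS]/= opprK.
have -> : ztwist (pseries_aut rho) (-1) (f (q + 1)) = pseries_aut rho (f (q + 1)).
  by [].
rewrite pseries_t_mul; case: ifP => // q0; rewrite f1 ?mul0r //; lia.
Qed.

End Shift.

(** * Operators on row vectors and their windows *)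

Section Windows.
Variables (A : pzRingType) (rho : ring_aut A).
Local Notation S := (pseries rho).
Local Notation LS := (laurent (pseries_aut rho)).
Local Notation scal s := (lmono (pseries_aut rho) s 0).

(** Row vectors over S_rho((z)) form a left [S]-module through the constant
    series. *)
Definition scal_linear m n (X : 'rV[LS]_m -> 'rV[LS]_n) :=
  forall (s : S) x y, X (scal s *: x + y) = scal s *: X x + X y.

Section ScalLinear.
Variables (m n : nat) (X : 'rV[LS]_m -> 'rV[LS]_n).
Hypothesis linX : scal_linear X.

Lemma scal_linearD x y : X (x + y) = X x + X y.
Proof. by have := linX 1 x y; rewrite !scale1r. Qed.

Lemma scal_linear0 : X 0 = 0.
Proof. by apply: (@addIr _ (X 0)); rewrite -scal_linearD !add0r. Qed.

Lemma scal_linearZ (s : S) x : X (scal s *: x) = scal s *: X x.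
Proof. by rewrite -[_ *: x]addr0 linX scal_linear0 addr0. Qed.
End ScalLinear.

Section Window.
Variables (lo : int) (c n : nat).

(** The coefficients of z^lo, ..., z^(lo + c - 1) are free [S]-coordinates on the
    lattice quotient z^lo / z^(lo + c). *)
Definition to_window (x : 'rV[LS]_n) : 'rV[S]_(c * n) :=
  mxvec (\matrix_(j < c, i < n) x 0 i (lo + j%:Z)).
Definition of_window (u : 'rV[S]_(c * n)) : 'rV[LS]_n :=
  \row_i \sum_(j < c) lmono _ (vec_mx u j i) (lo + j%:Z).

Lemma of_window_coef u i q : of_window u 0 i q =
  \sum_(j < c) if q == lo + j%:Z then vec_mx u j i else 0.
Proof. by rewrite mxE lcoef_sum. Qed.

Lemma to_windowP s x y :
  to_window (scal s *: x + y) = s *: to_window x + to_window y.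
Proof.
rewrite -linearP; congr mxvec; apply/matrixP => j i; rewrite !mxE.
rewrite -[LHS]/((scal s * x 0 i) (lo + j%:Z) + y 0 i (lo + j%:Z)).
by rewrite lmono_mul_coef subr0.
Qed.

Lemma of_windowP s u v :
  of_window (s *: u + v) = scal s *: of_window u + of_window v.
Proof.
apply/rowP => i; apply: laurent_ext => q; rewrite of_window_coef !mxE.
rewrite -[RHS]/((scal s * _) q + _) lmono_mul_coef !lcoef_sum subr0 mulr_sumr.
rewrite -big_split /=; apply: eq_bigr => j _; rewrite linearP !mxE.
by case: ifP; rewrite // mulr0 addr0.
Qed.

Lemma of_windowK : cancel of_window to_window.
Proof.
move=> u; rewrite -[RHS]vec_mxK; congr mxvec; apply/matrixP => j i.
rewrite mxE of_window_coef (bigD1 j) //= eqxx big1 ?addr0 // => k kj.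
by case: eqP => // jk; case/eqP: kj; apply: val_inj => /=; lia.
Qed.

Lemma to_windowD x y : to_window (x + y) = to_window x + to_window y.
Proof. by have := to_windowP 1 x y; rewrite !scale1r. Qed.

Lemma to_window_deep x : ord_ge (lo + c%:Z) x -> to_window x = 0.
Proof.
move=> xc; rewrite -(linear0 mxvec); congr mxvec; apply/matrixP => j i.
by rewrite !mxE xc //; have := ltn_ord j; lia.
Qed.

Lemma of_window_ord u : ord_ge lo (of_window u).
Proof.
move=> o i q qlo; rewrite (ord1 o) of_window_coef big1 // => j _.
by case: eqP => // ?; lia.
Qed.

Lemma to_windowK x : ord_ge lo x -> ord_ge (lo + c%:Z) (x - of_window (to_window x)).
Proof.
move=> xlo o i q qc; rewrite (ord1 o) !mxE.
rewrite -[LHS]/(x 0 i q - (\sum_(j < c) lmono _ _ _ : LS) q) lcoef_sum /=.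
have [qlo|loq] := ltP q lo.
  rewrite xlo // big1 ?subr0 // => j _; case: eqP => // ?; lia.
have qn : (`|q - lo| < c)%N by lia.
rewrite (bigD1 (Ordinal qn)) //= mxvecK mxE /=.
have -> : lo + `|q - lo|%N%:Z = q by lia.
rewrite eqxx big1 ?addr0 ?subrr // => k kj; case: eqP => // qk.
by case/eqP: kj; apply: val_inj => /=; lia.
Qed.

Lemma to_window_aug x y : map_mx (@laurent_aug A rho) x = map_mx (@laurent_aug A rho) y ->
  map_mx (@pseries_aug A rho) (to_window x) = map_mx (@pseries_aug A rho) (to_window y).
Proof.
move=> xy; rewrite !map_mxvec; congr mxvec; apply/matrixP => j i; rewrite !mxE.
have /rowP/(_ i) := xy; rewrite !mxE.
by move/(congr1 (fun f : laurent rho => f (lo + j%:Z))).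
Qed.

Definition window_mx (X : 'rV[LS]_n -> 'rV[LS]_n) : 'M[S]_(c * n) :=
  lin1_mx (to_window \o (X \o of_window)).

Lemma mul_window_mx X u : scal_linear X ->
  u *m window_mx X = to_window (X (of_window u)).
Proof.
move=> linX; have wX_lin : linear (to_window \o (X \o of_window)).
  by move=> s v w; rewrite /= of_windowP linX to_windowP.
pose H := GRing.isLinear.Build _ _ _ _ _ wX_lin.
pose wX : {linear 'rV[S]_(c * n) -> 'rV[S]_(c * n)} :=
  HB.pack (to_window \o (X \o of_window)) H.
exact: (mul_rV_lin1 wX).
Qed.

End Window.

(** Such an operator [X] induces the identity on z^hi, on the quotient by z^lo and
    modulo t, so that all it does is seen on the finite free [S]-module
    z^lo / z^hi. *)
Record tame (lo hi : int) n (X : 'rV[LS]_n -> 'rV[LS]_n) : Prop := Tame {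
  tame_lin : scal_linear X;
  tame_aug : forall x, map_mx (@laurent_aug A rho) (X x) = map_mx (@laurent_aug A rho) x;
  tame_im : forall x, ord_ge lo (X x - x);
  tame_ker : forall x, ord_ge hi x -> X x = x }.

Lemma tame_le lo hi lo' hi' n (X : 'rV[LS]_n -> 'rV[LS]_n) :
  lo' <= lo -> hi <= hi' -> tame lo hi X -> tame lo' hi' X.
Proof.
move=> llo hhi [lX aX iX kX]; split=> // x; first exact: ord_ge_le (iX x).
by move=> xhi; apply: kX; exact: ord_ge_le xhi.
Qed.

Lemma tame_witt lo hi n (X : 'rV[LS]_n -> 'rV[LS]_n) lo' c :
  tame lo hi X -> witt_mx (window_mx lo' c X).
Proof.
move=> tX; apply: eq_mulmx_rV => u; rewrite mulmx1.
pose v := map_mx (@pseries_const A rho) u.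
have <- : map_mx (@pseries_aug A rho) v = u by apply/rowP => i; rewrite !mxE.
rewrite -map_mxM mul_window_mx; last exact: tame_lin tX.
by rewrite -[in RHS](of_windowK lo' v); apply: to_window_aug; exact: tame_aug tX _.
Qed.

Lemma window_mx_comp lo c n (X Y : 'rV[LS]_n -> 'rV[LS]_n) :
  tame lo (lo + c%:Z) X -> tame lo (lo + c%:Z) Y ->
  window_mx lo c (Y \o X) = window_mx lo c X *m window_mx lo c Y.
Proof.
move=> [linX _ imX _] [linY _ _ kY]; apply: eq_mulmx_rV => u.
rewrite mulmxA !mul_window_mx //; last by move=> s x y; rewrite /= linX linY.
set w := X _; have wlo : ord_ge lo w.
  rewrite -[w](subrK (of_window lo u)); apply: ord_geD; first exact: imX.
  exact: of_window_ord.
have wK := to_windowK wlo; rewrite /= -/w.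
rewrite -[w in LHS](subrK (of_window lo (to_window lo c w))) (scal_linearD linY).
by rewrite to_windowD kY // to_window_deep ?add0r.
Qed.

(** Here [X' - 1] is the composite of [N'], [X - 1] and [N]. Let [U] be the map
    between the windows induced by [N'] followed by [X - 1], and [V] the map
    induced by [N]: the window matrices are [1 + U *m V] for [X'] and [1 + V *m U]
    for [X], the latter since [N *m N' = 1]. The order hypotheses say that nothing
    is lost by passing to the windows. *)
Lemma window_mx_cyclic m n (X : 'rV[LS]_m -> 'rV[LS]_m) (X' : 'rV[LS]_n -> 'rV[LS]_n)
    (N : 'M[LS]_(m, n)) (N' : 'M[LS]_(n, m)) (lo : int) c (lo' : int) c' :
  N *m N' = 1%:M -> scal_linear X -> scal_linear X' ->
  (forall y, X' y - y = (X (y *m N') - y *m N') *m N) ->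
  (forall x, ord_ge lo (X x - x)) ->
  (forall x : 'rV_m, ord_ge (lo + c%:Z) x -> ord_ge (lo' + c'%:Z) (x *m N)) ->
  (forall x : 'rV_m, ord_ge lo x -> ord_ge lo' (x *m N)) ->
  (forall y : 'rV_n, ord_ge (lo' + c'%:Z) y -> X (y *m N') = y *m N') ->
  witt_mx (window_mx lo c X) -> witt_mx (window_mx lo' c' X') ->
  gl_torsion (window_mx lo c X) = gl_torsion (window_mx lo' c' X').
Proof.
move=> NN' linX linX' X'E imX cN loN kX wX wX'.
pose F x := X x - x.
have linF : scal_linear F.
  by move=> s x y; rewrite /F linX opprD addrACA scalerBr.
pose a (u : 'rV[S]_(c' * n)) := to_window lo c (F (of_window lo' u *m N')).
pose b (v : 'rV[S]_(c * m)) := to_window lo' c' (of_window lo v *m N).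
have a_lin : linear a.
  by move=> s u v; rewrite /a of_windowP mulmxDl -scalemxAl linF to_windowP.
have b_lin : linear b.
  by move=> s u v; rewrite /b of_windowP mulmxDl -scalemxAl to_windowP.
pose Ha := GRing.isLinear.Build _ _ _ _ a a_lin.
pose U := lin1_mx (HB.pack a Ha : {linear 'rV_(c' * n) -> 'rV_(c * m)}).
pose Hb := GRing.isLinear.Build _ _ _ _ b b_lin.
pose V := lin1_mx (HB.pack b Hb : {linear 'rV_(c * m) -> 'rV_(c' * n)}).
have UE u : u *m U = a u by exact: mul_rV_lin1.
have VE v : v *m V = b v by exact: mul_rV_lin1.
have X'W : window_mx lo' c' X' = 1%:M + U *m V.
  apply: eq_mulmx_rV => u; rewrite mul_window_mx // mulmxDr mulmx1 mulmxA UE VE.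
  rewrite -[X' _](addrNK (of_window lo' u)) addrC to_windowD of_windowK X'E.
  congr (_ + _); rewrite /b /a -/(F _); set w := F _.
  rewrite -[w in LHS](subrK (of_window lo (to_window lo c w))) mulmxDl to_windowD.
  rewrite to_window_deep ?add0r //; apply: cN; apply: to_windowK; exact: imX.
have XW : window_mx lo c X = 1%:M + V *m U.
  apply: eq_mulmx_rV => v; rewrite mul_window_mx // mulmxDr mulmx1 mulmxA VE UE.
  rewrite -[X _](addrNK (of_window lo v)) addrC to_windowD of_windowK.
  congr (_ + to_window _ _ _); rewrite -/(F _) /b; set w := of_window lo v.
  have wN := to_windowK (c := c') (loN _ (of_window_ord (c := c) v)).
  rewrite -/w in wN; set y := of_window lo' _ in wN *.
  have <- : (w *m N - y) *m N' + y *m N' = w.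
    by rewrite -mulmxDl subrK -mulmxA NN' mulmx1.
  by rewrite (scal_linearD linF) /F kX // subrr add0r.
have [hX _] := witt_mx_torsion wX; have [hX' _] := witt_mx_torsion wX'.
by rewrite XW X'W gl_torsion_1addC -?XW -?X'W.
Qed.

(** Both windows are compared with the one from the larger lower end to the larger
    upper end, by [window_mx_cyclic] for [N = N' = 1]. *)
Lemma window_mx_indep n (X : 'rV[LS]_n -> 'rV[LS]_n) (lo : int) c (lo' : int) c' :
  tame lo (lo + c%:Z) X -> tame lo' (lo' + c'%:Z) X ->
  gl_torsion (window_mx lo c X) = gl_torsion (window_mx lo' c' X).
Proof.
move=> tX tX'; pose lo1 : int := Num.max lo lo'.
pose hi1 : int := Num.max (lo + c%:Z) (lo' + c'%:Z).
pose c1 := `|hi1 - lo1|%N.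
have im1 x : ord_ge lo1 (X x - x).
  move=> i j q; rewrite lt_max => /orP[]; [apply: (tame_im tX)|apply: (tame_im tX')].
have aux l d : tame l (l + d%:Z) X -> l <= lo1 -> l + d%:Z <= lo1 + c1%:Z ->
    gl_torsion (window_mx lo1 c1 X) = gl_torsion (window_mx l d X).
  move=> tl llo ldc; have linX := tame_lin tl.
  apply: (@window_mx_cyclic _ _ X X 1%:M 1%:M); rewrite ?mulmx1 //.
  - by move=> y; rewrite !mulmx1.
  - by move=> x; rewrite mulmx1; exact: ord_ge_le.
  - by move=> x; rewrite mulmx1; exact: ord_ge_le.
  - by move=> x; rewrite mulmx1; exact: (tame_ker tl).
  - exact: tame_witt tl.
  - exact: tame_witt tl.
by rewrite -!aux //; rewrite /c1 /hi1 /lo1; lia.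
Qed.

Lemma tame_conj m n (X : 'rV[LS]_m -> 'rV[LS]_m) (X' : 'rV[LS]_n -> 'rV[LS]_n)
    (N : 'M[LS]_(m, n)) (N' : 'M[LS]_(n, m)) (r : nat) lo hi :
  ord_ge (- r%:Z) N -> ord_ge (- r%:Z) N' ->
  (forall y, X' y - y = (X (y *m N') - y *m N') *m N) ->
  tame lo hi X -> tame (lo - r%:Z) (hi + r%:Z) X'.
Proof.
move=> oN oN' X'E [linX augX imX kX].
have {}X'E y : X' y = y + (X (y *m N') - y *m N') *m N by rewrite -X'E addrC subrK.
split=> [s x y|x|x|x xhi].
- have E : (scal s *: x + y) *m N' = scal s *: (x *m N') + y *m N'.
    by rewrite mulmxDl -scalemxAl.
  rewrite !X'E E linX opprD [X in X *m N]addrACA -scalerBr mulmxDl -scalemxAl.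
  by rewrite [in RHS]scalerDr addrACA.
- by rewrite X'E map_mxD map_mxM map_mxB augX subrr mul0mx addr0.
- by rewrite X'E [x + _]addrC addrK; apply: ord_geM.
- rewrite X'E kX ?subrr ?mul0mx ?addr0 //.
  by have := ord_geM xhi oN'; apply: ord_ge_le; lia.
Qed.

(** For square [N] this is invariance under conjugation; for [N], [N'] the
    inclusion and the projection of a block, it is invariance under
    stabilization. *)
Lemma window_mx_conj m n (X : 'rV[LS]_m -> 'rV[LS]_m) (X' : 'rV[LS]_n -> 'rV[LS]_n)
    (N : 'M[LS]_(m, n)) (N' : 'M[LS]_(n, m)) (lo : int) c (lo' : int) c' :
  N *m N' = 1%:M ->
  (forall y, X' y - y = (X (y *m N') - y *m N') *m N) ->
  tame lo (lo + c%:Z) X -> tame lo' (lo' + c'%:Z) X' ->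
  gl_torsion (window_mx lo c X) = gl_torsion (window_mx lo' c' X').
Proof.
move=> NN' X'E tX tX'.
have [r1 oN1] := ord_ge_exists N; have [r2 oN2] := ord_ge_exists N'.
pose r := (r1 + r2)%N.
have oN : ord_ge (- r%:Z) N by apply: ord_ge_le oN1; lia.
have oN' : ord_ge (- r%:Z) N' by apply: ord_ge_le oN2; lia.
have tX1 : tame lo (lo + (c + r + r)%N%:Z) X by apply: tame_le tX; lia.
have tX1' : tame (lo - r%:Z) (lo - r%:Z + (c + r + r)%N%:Z) X'.
  by apply: tame_le (tame_conj oN oN' X'E tX); lia.
rewrite (window_mx_indep tX tX1) (window_mx_indep tX' tX1').
apply: (window_mx_cyclic NN' _ _ X'E).
- exact: tame_lin tX.
- exact: tame_lin tX'.
- exact: tame_im tX.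
- by move=> x xo; have := ord_geM xo oN; apply: ord_ge_le; lia.
- by move=> x xo; have := ord_geM xo oN; apply: ord_ge_le; lia.
- move=> y yo; apply: (tame_ker tX).
  by have := ord_geM yo oN'; apply: ord_ge_le; lia.
- exact: tame_witt tX.
- exact: tame_witt tX'.
Qed.

End Windows.

(** * The homomorphism to the Witt vectors *)

Section Commutator.
Variables (A : pzRingType) (rho : ring_aut A).
Local Notation S := (pseries rho).
Local Notation L := (laurent rho).
Local Notation LS := (laurent (pseries_aut rho)).
Local Notation scal s := (lmono (pseries_aut rho) s 0).
Local Notation t := (pseries_t rho).
Local Notation ext := (map_mx (@laurent_ext_scalars A rho)).
Local Notation aug := (map_mx (@laurent_aug A rho)).
Local Notation G := (map_mx (@resolvent A rho)).
Local Notation Ginv := (map_mx (@resolvent_inv A rho)).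

(** With [N] inverse to [M], this is M^-1 G M G^-1, maps being composed from left
    to right. *)
Definition commutator_op n (M N : 'M[L]_n) (x : 'rV[LS]_n) : 'rV[LS]_n :=
  Ginv (G (x *m ext N) *m ext M).

Lemma map_resolventK m n : cancel (G : 'M_(m, n) -> _) Ginv.
Proof. by move=> x; apply/matrixP => i j; rewrite !mxE resolventK. Qed.

Lemma map_resolvent_invK m n : cancel (Ginv : 'M_(m, n) -> _) G.
Proof. by move=> x; apply/matrixP => i j; rewrite !mxE resolvent_invK. Qed.

Lemma map_resolvent_inj m n : injective (G : 'M_(m, n) -> _).
Proof. exact: can_inj (@map_resolventK m n). Qed.

Lemma map_resolvent_scal n s (x : 'rV[LS]_n) : G (scal s *: x) = scal s *: G x.
Proof. by apply/rowP => i; rewrite !mxE resolvent_scale. Qed.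

Lemma commutator_opP n (M N : 'M[L]_n) x :
  G (commutator_op M N x) = G (x *m ext N) *m ext M.
Proof. exact: map_resolvent_invK. Qed.

Lemma ord_ge_resolventB m n (x : 'M[LS]_(m, n)) : ord_ge 0 (G x - x).
Proof.
move=> i j q q0; rewrite !mxE -[LHS]/(resolvent (x i j) q - x i j q).
by rewrite resolvent_coef; case: ifP; rewrite ?subrr //; lia.
Qed.

Lemma map_resolvent_deep n (x : 'rV[LS]_n) : ord_ge 1 x ->
  G x = (1 - lmono _ t (-1)) *: x.
Proof. by move=> x1; apply/rowP => i; rewrite !mxE resolvent_deep //; apply: x1. Qed.

(** On z^1 the operator G is left multiplication by 1 - t z^-1, which commutes
    with [M]; this gives the upper end, as [x] and [x *m N] are both in z^1 for [x]
    in z^(r + 1). For the lower end, G - 1 has image in z^0, and [M] lowers the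
    order by at most [r]. *)
Lemma commutator_op_tame n (M N : 'M[L]_n) (r : nat) :
  N *m M = 1%:M -> ord_ge (- r%:Z) M -> ord_ge (- r%:Z) N ->
  tame (- r%:Z) (r%:Z + 1) (commutator_op M N).
Proof.
move=> NM /ord_ge_ext_scalars oM /ord_ge_ext_scalars oN.
have eNM : ext N *m ext M = 1%:M by rewrite -map_mxM NM map_mx1.
split=> [s x y|x|x|x xr].
- apply: map_resolvent_inj; rewrite commutator_opP map_mxD map_resolvent_scal.
  rewrite !commutator_opP mulmxDl -scalemxAl map_mxD map_resolvent_scal mulmxDl.
  by rewrite -scalemxAl.
- have augG m k (y : 'M[LS]_(m, k)) : aug (G y) = aug y.
    by apply/matrixP => i j; rewrite !mxE laurent_aug_resolvent.
  rewrite -[LHS]augG commutator_opP map_mxM augG -map_mxM -mulmxA eNM.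
  by rewrite mulmx1.
- suff oG : ord_ge (- r%:Z) (G (commutator_op M N x - x)).
    move=> i j q qr; rewrite -(oG i j q qr) [in RHS]mxE resolvent_coef.
    by case: ifP => //; lia.
  rewrite map_mxB commutator_opP.
  have -> : G (x *m ext N) *m ext M - G x =
      (G (x *m ext N) - x *m ext N) *m ext M - (G x - x).
    by rewrite mulmxBl -mulmxA eNM mulmx1 opprB addrA subrK.
  apply: ord_geD; last first.
    by apply/ord_geN/(ord_ge_le _ (@ord_ge_resolventB _ _ _)); lia.
  by have := ord_geM (@ord_ge_resolventB _ _ (x *m ext N)) oM; rewrite add0r.
- apply: map_resolvent_inj; rewrite commutator_opP !map_resolvent_deep.
  + by rewrite -scalemxAl -mulmxA eNM mulmx1.
  + by apply: ord_ge_le xr; lia.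
  + by have := ord_geM xr oN; apply: ord_ge_le; lia.
Qed.

Lemma commutator_op_tame_exists n (M N : 'M[L]_n) : N *m M = 1%:M ->
  exists lo c, tame lo (lo + Posz c) (commutator_op M N).
Proof.
move=> NM; have [r1 oM] := ord_ge_exists M; have [r2 oN] := ord_ge_exists N.
pose r := (r1 + r2)%N; exists (- r%:Z), (r + r).+1.
have := @commutator_op_tame _ M N r NM; rewrite (_ : _ + Posz _ = r%:Z + 1); last by lia.
by apply; [apply: ord_ge_le oM|apply: ord_ge_le oN]; lia.
Qed.

Lemma commutator_torsion_exists n (M : 'M[L]_n) : exists d : W1 rho,
  forall N lo c, M *m N = 1%:M -> N *m M = 1%:M ->
    tame lo (lo + Posz c) (commutator_op M N) ->
    \val d = gl_torsion (window_mx lo c (commutator_op M N)).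
Proof.
have [[N [MN NM]]|nM] := pselect (invertible_mx M); last first.
  by exists 0 => N lo c MN NM; case: nM; exists N.
have [lo [c tX]] := commutator_op_tame_exists NM.
have [_ wX] := witt_mx_torsion (tame_witt lo c tX).
exists (exist (fun x => x \in @witt_torsions A rho) _ wX) => N' lo' c' MN' N'M tX' /=.
have eN : N' = N by rewrite -[N']mulmx1 -MN mulmxA N'M mul1mx.
by move: tX'; rewrite eN => tX'; exact: window_mx_indep.
Qed.

Definition commutator_torsion n (M : 'M[L]_n) : W1 rho :=
  projT1 (cid (commutator_torsion_exists M)).

Lemma commutator_torsionE n (M N : 'M[L]_n) lo c :
  M *m N = 1%:M -> N *m M = 1%:M ->
  tame lo (lo + Posz c) (commutator_op M N) ->
  \val (commutator_torsion M) = gl_torsion (window_mx lo c (commutator_op M N)).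
Proof. exact: (projT2 (cid (commutator_torsion_exists M))). Qed.

(** With Y = M2^-1 X_M1 M2, conjugate to X_M1, the operator of [M1 *m M2] is Y
    followed by X_M2. *)
Lemma commutator_torsionM n (M1 M2 : 'M[L]_n) :
  invertible_mx M1 -> invertible_mx M2 ->
  commutator_torsion (M1 *m M2) = commutator_torsion M1 + commutator_torsion M2.
Proof.
move=> [N1 [MN1 NM1]] [N2 [MN2 NM2]]; apply: val_inj.
have MN : M1 *m M2 *m (N2 *m N1) = 1%:M.
  by rewrite mulmxA -(mulmxA M1) MN2 mulmx1.
have NM : N2 *m N1 *m (M1 *m M2) = 1%:M.
  by rewrite mulmxA -(mulmxA N2) NM1 mulmx1.
have eMN : ext M2 *m ext N2 = 1%:M by rewrite -map_mxM MN2 map_mx1.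
have eNM : ext N2 *m ext M2 = 1%:M by rewrite -map_mxM NM2 map_mx1.
pose X1 := commutator_op M1 N1; pose X2 := commutator_op M2 N2.
pose Y y := X1 (y *m ext N2) *m ext M2.
have YE y : Y y - y = (X1 (y *m ext N2) - y *m ext N2) *m ext M2.
  by rewrite mulmxBl -mulmxA eNM mulmx1.
have [lo1 [c1 tX1]] := commutator_op_tame_exists NM1.
have [lo2 [c2 tX2]] := commutator_op_tame_exists NM2.
have [r1 oM] := ord_ge_exists (ext M2); have [r2 oN] := ord_ge_exists (ext N2).
pose r := (r1 + r2)%N.
have {}oM : ord_ge (- r%:Z) (ext M2) by apply: ord_ge_le oM; lia.
have {}oN : ord_ge (- r%:Z) (ext N2) by apply: ord_ge_le oN; lia.
have tY := tame_conj oM oN YE tX1.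
(* a window that contains the windows of all three operators *)
pose b : nat := (`|lo1| + c1 + `|lo2| + c2 + r)%N.
pose lo : int := - b%:Z; pose c : nat := (b + b)%N.
have {}tY : tame lo (lo + c%:Z) Y by apply: tame_le tY; lia.
have {}tX2 : tame lo (lo + c%:Z) X2 by apply: tame_le tX2; lia.
have {}tX1 : tame lo (lo + c%:Z) X1 by apply: tame_le tX1; lia.
have XE : commutator_op (M1 *m M2) (N2 *m N1) = X2 \o Y.
  apply/funext => x; apply: map_resolvent_inj; rewrite /= !commutator_opP.
  by rewrite /Y -(mulmxA _ _ (ext N2)) eMN mulmx1 commutator_opP !map_mxM !mulmxA.
have tX : tame lo (lo + c%:Z) (commutator_op (M1 *m M2) (N2 *m N1)).
  rewrite XE; case: tY tX2 => [lY aY iY kY] [lX aX iX kX].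
  split=> [s x y|x|x|x xhi] /=.
  - by rewrite lY lX.
  - by rewrite aX aY.
  - rewrite -(subrK (Y x) (X2 _)) -addrA; exact: ord_geD.
  - by rewrite kX kY.
rewrite (_ : \val (_ + _) =
  \val (commutator_torsion M1) + \val (commutator_torsion M2)) //.
rewrite (commutator_torsionE MN NM tX) (commutator_torsionE MN1 NM1 tX1).
rewrite (commutator_torsionE MN2 NM2 tX2) XE window_mx_comp // gl_torsionM.
- by rewrite (window_mx_conj eMN YE tX1 tY).
- by have [] := witt_mx_torsion (tame_witt lo c tY).
- by have [] := witt_mx_torsion (tame_witt lo c tX2).
Qed.

Lemma commutator_torsion_stab m n (M : 'M[L]_m) (M' : 'M[L]_n) (N : 'M[L]_m)
    (N' : 'M[L]_n) (I : 'M[LS]_(m, n)) (J : 'M[LS]_(n, m)) :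
  M *m N = 1%:M -> N *m M = 1%:M -> M' *m N' = 1%:M -> N' *m M' = 1%:M ->
  I *m J = 1%:M ->
  (forall y, commutator_op M' N' y - y =
     (commutator_op M N (y *m J) - y *m J) *m I) ->
  commutator_torsion M' = commutator_torsion M.
Proof.
move=> MN NM MN' NM' IJ XE; apply: val_inj.
have [lo [c tX]] := commutator_op_tame_exists NM.
have [lo' [c' tX']] := commutator_op_tame_exists NM'.
rewrite (commutator_torsionE MN NM tX) (commutator_torsionE MN' NM' tX').
by rewrite (window_mx_conj IJ XE tX tX').
Qed.

Lemma commutator_torsion_stabr m n (M : 'M[L]_m) : invertible_mx M ->
  commutator_torsion (block_mx M 0 0 (1%:M : 'M_n)) = commutator_torsion M.
Proof.
move=> [N [MN NM]].
apply: (@commutator_torsion_stab _ _ M _ N (block_mx N 0 0 1%:M)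
  (row_mx 1%:M 0) (col_mx 1%:M 0)) => //.
- by rewrite mulmx_block !(mulmx0, mul0mx, mulmx1, addr0, add0r) MN scalar_mx_block.
- by rewrite mulmx_block !(mulmx0, mul0mx, mulmx1, addr0, add0r) NM scalar_mx_block.
- by rewrite mul_row_col mulmx1 mulmx0 addr0.
move=> y; rewrite -[y]hsubmxK; set x := lsubmx y; set x' := rsubmx y.
rewrite mul_row_col mulmx1 mulmx0 addr0 mul_mx_row mulmx1 mulmx0.
have -> : commutator_op (block_mx M 0 0 1%:M) (block_mx N 0 0 1%:M) (row_mx x x') =
          row_mx (commutator_op M N x) x'.
  rewrite /commutator_op !map_block_mx !map_mx0 !map_mx1 mul_row_block.
  rewrite !(mulmx0, mulmx1, addr0, add0r) map_row_mx mul_row_block.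
  by rewrite !(mulmx0, mulmx1, addr0, add0r) map_row_mx map_resolventK.
by rewrite opp_row_mx add_row_mx subrr.
Qed.

Lemma commutator_torsion_stabl m n (M : 'M[L]_n) : invertible_mx M ->
  commutator_torsion (block_mx (1%:M : 'M_m) 0 0 M) = commutator_torsion M.
Proof.
move=> [N [MN NM]].
apply: (@commutator_torsion_stab _ _ M _ N (block_mx 1%:M 0 0 N)
  (row_mx 0 1%:M) (col_mx 0 1%:M)) => //.
- by rewrite mulmx_block !(mulmx0, mul0mx, mulmx1, addr0, add0r) MN scalar_mx_block.
- by rewrite mulmx_block !(mulmx0, mul0mx, mulmx1, addr0, add0r) NM scalar_mx_block.
- by rewrite mul_row_col mulmx1 mulmx0 add0r.
move=> y; rewrite -[y]hsubmxK; set x := lsubmx y; set x' := rsubmx y.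
rewrite mul_row_col mulmx1 mulmx0 add0r mul_mx_row mulmx1 mulmx0.
have -> : commutator_op (block_mx 1%:M 0 0 M) (block_mx 1%:M 0 0 N) (row_mx x x') =
          row_mx x (commutator_op M N x').
  rewrite /commutator_op !map_block_mx !map_mx0 !map_mx1 mul_row_block.
  rewrite !(mulmx0, mulmx1, addr0, add0r) map_row_mx mul_row_block.
  by rewrite !(mulmx0, mulmx1, addr0, add0r) map_row_mx map_resolventK.
by rewrite opp_row_mx add_row_mx subrr.
Qed.

End Commutator.

(** * Values on constants, on z and on Witt vectors *)

Section Evaluation.
Variables (A : pzRingType) (rho : ring_aut A).
Local Notation S := (pseries rho).
Local Notation L := (laurent rho).
Local Notation LS := (laurent (pseries_aut rho)).
Local Notation scal s := (lmono (pseries_aut rho) s 0).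
Local Notation t := (pseries_t rho).
Local Notation zpow k := (lmono (pseries_aut rho) 1 k).
Local Notation ext := (@laurent_ext_scalars A rho).

Lemma mul_lmono_coef (f : LS) (a : S) (k : int) q :
  (f * lmono _ a k) q = f (q - k) * ztwist (pseries_aut rho) (q - k) a.
Proof.
rewrite [LHS]/= /lmul_coef (@fsum_seq _ [:: q - k]) //=.
  by rewrite big_seq1 (_ : q - (q - k) == k) //; lia.
move=> l; rewrite inE => lk; have -> : (q - l == k) = false by lia.
by rewrite rmorph0 mulr0.
Qed.

(** Right multiplication by a constant preserves degrees in z, hence commutes with
    the truncation. *)
Lemma resolvent_mulr_scal (f : LS) (a : S) :
  resolvent (f * scal a) = resolvent f * scal a.
Proof.
apply: laurent_ext => q; rewrite mul_lmono_coef !resolvent_coef !mul_lmono_coef.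
rewrite !subr0; case: ifP => // _; rewrite mulrBl ztwistD -!mulrA -pseries_t_mul.
congr (_ - _ * (t * _)).
rewrite [LHS]ztwist_raut; congr ztwist; exact: (raut_invK (pseries_aut rho)).
Qed.

Lemma commutator_torsion_const n (M : 'M[A]_n) : invertible_mx M ->
  commutator_torsion (map_mx (laurent_const rho) M) = 0.
Proof.
move=> [N [MN NM]]; apply: val_inj.
have cMN : map_mx (laurent_const rho) M *m map_mx (laurent_const rho) N = 1%:M.
  by rewrite -map_mxM MN map_mx1.
have cNM : map_mx (laurent_const rho) N *m map_mx (laurent_const rho) M = 1%:M.
  by rewrite -map_mxM NM map_mx1.
have [lo [c tX]] := commutator_op_tame_exists cNM.
rewrite (commutator_torsionE cMN cNM tX).
have extc a : ext (laurent_const rho a) = scal (pseries_const rho a).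
  by apply: laurent_ext => q /=; case: ifP; rewrite ?rmorph0.
have XE x : commutator_op (map_mx (laurent_const rho) M)
    (map_mx (laurent_const rho) N) x = x.
  apply: map_resolvent_inj; rewrite commutator_opP.
  rewrite -[in RHS](mulmx1 x) -(map_mx1 ext) -cNM map_mxM mulmxA.
  move: (x *m _) => y; apply/rowP => i; rewrite !mxE raddf_sum.
  by apply: eq_bigr => j _; rewrite !mxE extc /= resolvent_mulr_scal.
transitivity (gl_torsion (1%:M : 'M[S]_(c * n))); last exact: gl_torsion1.
congr gl_torsion; apply: eq_mulmx_rV => u.
by rewrite mul_window_mx ?XE ?of_windowK ?mulmx1 //; exact: tame_lin tX.
Qed.

Lemma map_resolvent_scalar (f : LS) :
  map_mx (@resolvent A rho) (f%:M : 'M_1) = (resolvent f)%:M.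
Proof. by apply/rowP => i; rewrite !mxE; case: eqP => // _; rewrite raddf0. Qed.

(** The only power of z that X_z moves is z itself, which goes to z + t. Thus
    X_z - 1 factors through the coefficient of z and takes values in constants,
    where that coefficient is 0. *)
Lemma commutator_torsion_z :
  commutator_torsion ((laurent_z rho)%:M : 'M_1) = 0.
Proof.
apply: val_inj; pose z' := lmono rho 1 (-1).
have zz' : laurent_z rho * z' = 1.
  by rewrite [LHS]lmonoM rmorph1 mulr1 subrr.
have z'z : z' * laurent_z rho = 1.
  by rewrite [LHS]lmonoM rmorph1 mulr1 addNr.
have MN : (laurent_z rho)%:M *m z'%:M = 1%:M :> 'M_1 by rewrite -scalar_mxM zz'.
have NM : z'%:M *m (laurent_z rho)%:M = 1%:M :> 'M_1 by rewrite -scalar_mxM z'z.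
have [lo [c tX]] := commutator_op_tame_exists NM.
rewrite (commutator_torsionE MN NM tX).
pose X := commutator_op (laurent_z rho)%:M (z'%:M : 'M_1); rewrite -/X in tX *.
have extz k : ext (lmono rho 1 k) = zpow k.
  by apply: laurent_ext => q /=; case: ifP; rewrite ?rmorph0 ?rmorph1.
have ez : ext (laurent_z rho) = zpow 1 by exact: extz.
have ez' : ext z' = zpow (-1) by exact: extz.
have Xf (f : LS) : X f%:M = (f + scal (f 1 * t))%:M.
  apply: map_resolvent_inj; rewrite commutator_opP !map_scalar_mx /= ez ez'.
  rewrite -scalar_mxM !map_resolvent_scalar -scalar_mxM.
  congr (_%:M); apply: laurent_ext => q.
  rewrite mul_lmono_coef rmorph1 mulr1 !resolvent_coef !mul_lmono_coef !rmorph1.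
  rewrite !mulr1 /= !opprK !subrK.
  have [q0|q0|->] := ltgtP q 0.
  - have -> : (0 <= q - 1) = false by lia.
    by rewrite addr0.
  - have -> : (0 <= q - 1) = true by lia.
    have -> : (q + 1 == 0) = false by lia.
    by rewrite !addr0.
  - by rewrite /= add0r addr0 addrK.
have XE (x : 'rV_1) : X x = x + (scal (x 0 0 1 * t))%:M.
  by rewrite {1}[x]mx11_scalar Xf raddfD /= -mx11_scalar.
pose U0 (u : 'rV[S]_(c * 1)) : 'rV[S]_1 := (of_window lo u 0 0 1 * t)%:M.
pose V0 (v : 'rV[S]_1) : 'rV[S]_(c * 1) := to_window lo c (scal (v 0 0))%:M.
have U0E u : U0 u 0 0 = of_window lo u 0 0 1 * t.
  by rewrite [LHS]mxE eqxx mulr1n.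
have U_lin : linear U0.
  move=> s u v; rewrite /U0 of_windowP.
  move: (of_window lo u) (of_window lo v) => x y.
  apply/rowP => i; rewrite (ord1 i) !mxE !mulr1n.
  rewrite -[LHS]/(((scal s * x 0 0) 1 + y 0 0 1) * t) lmono_mul_coef subr0.
  by rewrite mulrDl mulrA.
have V_lin : linear V0.
  move=> s u v; rewrite /V0 -to_windowP; congr to_window.
  apply/rowP => i; rewrite (ord1 i) !mxE /= !mulr1n lmono_add; congr (_ + _).
  by rewrite [RHS]lmonoM addr0.
pose HU := GRing.isLinear.Build _ _ _ _ U0 U_lin.
pose U := lin1_mx (HB.pack U0 HU : {linear 'rV_(c * 1) -> 'rV_1}).
pose HV := GRing.isLinear.Build _ _ _ _ V0 V_lin.
pose V := lin1_mx (HB.pack V0 HV : {linear 'rV_1 -> 'rV_(c * 1)}).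
have UE u : u *m U = U0 u by exact: mul_rV_lin1.
have VE v : v *m V = V0 v by exact: mul_rV_lin1.
have XUV : window_mx lo c X = 1%:M + U *m V.
  apply: eq_mulmx_rV => u; rewrite mul_window_mx; last exact: tame_lin tX.
  rewrite mulmxDr mulmx1 mulmxA UE VE XE to_windowD of_windowK.
  by rewrite /V0 U0E.
have VU0 : V *m U = 0.
  apply: eq_mulmx_rV => v; rewrite mulmxA VE UE mulmx0 /U0 of_window_coef big1.
    by rewrite mul0r; apply/matrixP => i j; rewrite !mxE mul0rn.
  move=> j _; case: eqP => // jE; rewrite mxvecK !mxE eqxx mulr1n /= -jE.
  by [].
have [hX _] := witt_mx_torsion (tame_witt lo c tX); rewrite XUV in hX *.
have hY : invertible_mx (1%:M + V *m U) by rewrite VU0 addr0; exact: invertible_mx1.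
rewrite (gl_torsion_1addC hX hY); transitivity (gl_torsion (1%:M : 'M[S]_1)).
  by rewrite VU0 addr0.
exact: gl_torsion1.
Qed.

(** X_w sends 1 to the series h with h_q = [q = 0] + sum_(k >= 1) w_(q + k) t^k for
    q >= 0: both G h and G(w^-1) w equal 1 + T w. Its coefficient h_0 is w(t), which
    is thus the 1 x 1 matrix of X_w on the window z^0 / z^1. *)
Lemma commutator_torsion_witt (w : S) (hw : invertible w) : w 0%N = 1 ->
  \val (commutator_torsion (map_mx (@laurent_of_pseries A rho) (w%:M : 'M_1))) =
  torsion_unit hw.
Proof.
move=> w0; have [w' [ww' w'w]] := hw.
have w'0 : w' 0%N = 1.
  have := congr1 (@pseries_aug A rho) ww'; rewrite rmorphM rmorph1 /=.
  by rewrite /pseries_aug w0 mul1r.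
rewrite map_scalar_mx /=; set f := laurent_of_pseries w.
pose f' : L := laurent_of_pseries w'.
have ff' : f * f' = 1 by rewrite -rmorphM ww' rmorph1.
have f'f : f' * f = 1 by rewrite -rmorphM w'w rmorph1.
have MN : f%:M *m f'%:M = 1%:M :> 'M_1 by rewrite -scalar_mxM ff'.
have NM : f'%:M *m f%:M = 1%:M :> 'M_1 by rewrite -scalar_mxM f'f.
have ord_lps (v : S) : ord_ge 0 ((laurent_of_pseries v)%:M : 'M_1).
  by move=> i j [q|q] // _; rewrite (ord1 i) (ord1 j) mxE eqxx mulr1n.
have tX : tame 0 (0 + 1%N%:Z) (commutator_op f%:M (f'%:M : 'M_1)).
  by apply: (@commutator_op_tame _ _ _ _ _ 0); rewrite ?oppr0 //; apply: ord_lps.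
rewrite (commutator_torsionE MN NM tX).
set X := commutator_op _ _ in tX *.
pose P (q : nat) : S :=
  PSeries (fun k => if k == 0%N then (q == 0%N)%:R else w (q + k)%N).
have h_bounded : exists N : nat, forall q : int, q < - N%:Z ->
    (if q is Posz m then P m else 0) = 0.
  by exists 0 => -[].
pose h : LS := Laurent _ h_bounded.
have shift_witt (v : S) : v 0%N = 1 ->
    shift (ext (laurent_of_pseries v)) =
    lmono _ t (-1) * (ext (laurent_of_pseries v) - 1).
  move=> v0; apply: laurent_ext => q; rewrite lmono_mul_coef opprK.
  rewrite -[ztwist _ _ _]/(pseries_aut rho _) pseries_t_mul.
  rewrite -[RHS]/((ext (laurent_of_pseries v) (q + 1) -
                   (if q + 1 == 0 then 1 else 0)) * t).
  case: q => [q|[|q]].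
  - have -> : (Posz q + 1 == 0) = false by lia.
    by rewrite subr0.
  - by rewrite /= v0 -[pseries_const _ 1]/(1 : S) subrr mul0r.
  - have -> : Negz q.+1 + 1 = Negz q by lia.
    by rewrite /= rmorph0 subr0 mul0r.
have X1 : X 1%:M = h%:M.
  apply: map_resolvent_inj; rewrite commutator_opP mul1mx !map_scalar_mx.
  rewrite !map_resolvent_scalar -scalar_mxM.
  congr (_%:M).
  have -> : resolvent (ext f') * ext f = 1 + shift (ext f).
    rewrite /resolvent !shift_witt // mulrBl -rmorphM f'f rmorph1 -mulrA mulrBl.
    by rewrite -rmorphM f'f rmorph1 mul1r -mulrN opprB.
  apply: laurent_ext => q; rewrite resolvent_coef.
  case: q => [q|q]; last by rewrite /= addr0.
  have -> : Posz q + 1 = Posz q.+1 by lia.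
  apply: pseries_ext => k.
  rewrite -[LHS]/((if Posz q == 0 then 1 else 0 : S) k +
                  ((pseries_const rho (w (q + 1)%N) * t) k)) addn1.
  rewrite -[RHS]/(P q k - (P q.+1 * t) k) !mul_pseries_t.
  case: k => [|[|k]] /=.
  - by case: q => [|q] /=; rewrite addr0 subr0.
  - by case: q => [|q] /=; rewrite add0r subr0 addn1.
  - have -> : (q.+1 + k.+1 = q + k.+2)%N by lia.
    by rewrite subrr addr0; case: q.
rewrite /torsion_unit -(gl_torsionE (invertible_mx11 hw)).
congr gl_torsion; apply: eq_mulmx_rV => u.
rewrite mul_window_mx; last exact: tame_lin tX.
have -> : of_window 0 u = scal (vec_mx u 0 0) *: 1%:M.
  apply/rowP => i; rewrite (ord1 i) !mxE big_ord1 eqxx mulr1n addr0.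
  by rewrite [RHS]mulr1 mxE.
have -> : X (scal (vec_mx u 0 0) *: 1%:M) = scal (vec_mx u 0 0) *: h%:M.
  by rewrite -X1; exact: (scal_linearZ (tame_lin tX)).
apply/rowP => k; rewrite [RHS]mxE (bigD1 k) //= [_%:M k k]mxE eqxx mulr1n.
rewrite [X in _ + X]big1 ?addr0 => [|l /negPf lk]; last first.
  by rewrite mxE lk mulr0n mulr0.
case/mxvec_indexP: k => i j; rewrite (ord1 i) (ord1 j) mxvecE !mxE eqxx mulr1n.
rewrite -[LHS]/((scal _ * h) 0) lmono_mul_coef.
congr (_ * _); apply: pseries_ext => -[|k] //=.
Qed.

End Evaluation.

Theorem corollary0p1 (A : pzRingType) (rho : ring_aut A) :
  exists B2hat : {additive K1 (laurent rho) -> W1 rho},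
    [/\ cancel (C2hat rho) B2hat,
        forall x : K1 A, B2hat (K1_map (laurent_const rho) x) = 0
      & B2hat (torsion_unit (laurent_z_invertible rho)) = 0].
Proof.
have [B BE] := K1_functional (@commutator_torsionM A rho)
  (@commutator_torsion_stabr A rho) (@commutator_torsion_stabl A rho).
exists B; split.
- move=> x; apply: val_inj; rewrite /C2hat /=.
  have /asboolP[w [hw [w0 ->]]] := valP x.
  rewrite {1}/torsion_unit -gl_torsionE K1_map_gl_torsion; last exact: invertible_mx11.
  rewrite BE; last by apply: invertible_mx_map; exact: invertible_mx11.
  exact: commutator_torsion_witt.
- move=> x; pose f : {additive K1 A -> W1 rho} := B \o K1_map (laurent_const rho).
  apply: (@additive_K1_ext A (W1 rho) f \0) => a /=.
  have [n [M [hM ->]]] := torsion_is_mx a.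
  rewrite K1_map_gl_torsion // BE; last exact: invertible_mx_map.
  exact: commutator_torsion_const.
- rewrite /torsion_unit -gl_torsionE BE; last first.
    exact: invertible_mx11 (laurent_z_invertible rho).
  exact: commutator_torsion_z.
Qed.
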